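(* Let $n\ge1$. The set $B_n$ is a complex submanifold of $P_n$ of dimension $n$. In particular, $Pol_n^{nd}$ is an open subset of $B_n$.
   Context: $P_n$ is the space of monic polynomials of degree $2^n$ for which $0$ is a critical point, identified with $\mathbb{C}^{2^n-1}$ through the free coefficients (those of $x^i$, $0\le i<2^n$, $i\ne1$). $P_n^{nd}$ is the set of $F\in P_n$ having $2^n-1$ distinct critical points. $B_n$ is the set of $F\in P_n^{nd}$ such that $F$ has exactly $n$ critical values and there is a partition $L_0,\dots,L_{n-1}$ of the critical set of $F$ such that $L_0=\{0\}$, $L_i$ has $2^i$ elements, and $F(L_i)$ consists of a single point for each $i$. $Pol_n$ is the set of polynomials $P_{a_n}\circ\dots\circ P_{a_1}$, $P_a(z)=z^2+a$, $a_i\in\mathbb{C}$. $Pol_n^{nd}$ is the set of polynomials in $Pol_n\cap P_n^{nd}$ with $n$ distinct critical values; one has $Pol_n^{nd}\subset B_n$. *)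

(* Defs.v *)
From HB Require Import structures.
From mathcomp Require Import all_boot all_order all_algebra.
From mathcomp Require Import complex.
From mathcomp Require Import all_classical all_reals all_analysis.
From mathcomp Require Import zify.
Import Order.TTheory GRing.Theory Num.Theory.
Import numFieldNormedType.Exports.

Set Implicit Arguments.
Unset Strict Implicit.
Unset Printing Implicit Defensive.

Local Open Scope classical_set_scope.
Local Open Scope ring_scope.
Local Open Scope complex_scope.

(* The library equips an abstract numFieldType with its norm topology; here the
   same structure is made available on the concrete type R[i]. *)
HB.instance Definition _ (R : realType) :=
  NormedModule.copy R[i] (R[i] : numFieldType).

Section Submanifold.
Variable R : realType.

(* [differentiable] is Fréchet differentiability over the scalar field, which
   is R[i] here: the differential is C-linear. *)
Definition holomorphic_on (N M : nat) (U : set 'rV[R[i]]_N)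
    (f : 'rV[R[i]]_N -> 'rV[R[i]]_M) : Prop :=
  forall x, U x -> differentiable f x.

Definition biholomorphism (N : nat) (U V : set 'rV[R[i]]_N)
    (phi psi : 'rV[R[i]]_N -> 'rV[R[i]]_N) : Prop :=
  [/\ open U, open V,
      holomorphic_on U phi /\ holomorphic_on V psi,
      (forall x, U x -> V (phi x) /\ psi (phi x) = x) &
      (forall y, V y -> U (psi y) /\ phi (psi y) = y)].

(* Embedded, not necessarily closed, submanifold of C^N: near each of its
   points, M is straightened to C^d x {0} by a biholomorphic change of
   coordinates of the ambient space. *)
Definition complex_submanifold (N d : nat) (M : set 'rV[R[i]]_N) : Prop :=
  (d <= N)%N /\
  forall p, M p ->
    exists U V : set 'rV[R[i]]_N, exists phi psi : 'rV[R[i]]_N -> 'rV[R[i]]_N,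
      [/\ U p, biholomorphism U V phi psi &
          phi @` (U `&` M) =
            V `&` [set w | forall j : 'I_N, (d <= j)%N -> w ord0 j = 0]].

End Submanifold.

Section Polynomials.
Variable R : realType.
Implicit Types (F : {poly R[i]}) (n : nat).

Definition critical_points F : set R[i] := [set z | root (deriv F) z].

Definition critical_values F : set R[i] :=
  (fun z => F.[z]) @` critical_points F.

Definition Pn n : set {poly R[i]} :=
  [set F | [/\ F \is monic, size F = (2 ^ n).+1 & critical_points F 0]].

(* [bump 1] enumerates the exponents 0, 2, 3, 4, ... *)
Definition coef_vec n F : 'rV[R[i]]_(2 ^ n - 1) :=
  \row_(j < 2 ^ n - 1) F`_(bump 1 j).

Lemma coef_vec_bij n : (0 < n)%N -> set_bij (Pn n) setT (coef_vec n).
Proof.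
move=> n0.
have n1 : (1 < 2 ^ n)%N by rewrite -[1%N](expn0 2) ltn_exp2l.
have crit0 F : critical_points F 0 <-> F`_1 = 0.
  rewrite /critical_points /= /root horner_coef0 coef_deriv mulr1n.
  by split=> [/eqP|->].
have bumpP i : (i < 2 ^ n)%N -> i != 1%N ->
    exists j : 'I_(2 ^ n - 1), bump 1 j = i.
  move=> il i1; have jl : (unbump 1 i < 2 ^ n - 1)%N.
    rewrite /unbump; move: il i1 n1; case: i => [|[|i]] //= *; lia.
  by exists (Ordinal jl); rewrite /= unbumpKcond (negbTE i1) add0n.
have bump_lt (j : 'I_(2 ^ n - 1)) : (bump 1 j < 2 ^ n)%N.
  by rewrite /bump; have := ltn_ord j; case: (1 <= j)%N; lia.
split=> // [F G /set_mem [mF sF /crit0 F1] /set_mem [mG sG /crit0 G1] FG|v _].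
  apply/polyP => i; have [il|ilt] := ltnP i (2 ^ n); last first.
    move: ilt; rewrite leq_eqVlt => /orP[/eqP <-|ilt].
      have := mF; have := mG.
      by rewrite !monicE !lead_coefE sF sG => /eqP -> /eqP ->.
    by rewrite !nth_default ?sF ?sG.
  have [->|i1] := eqVneq i 1%N; first by rewrite F1 G1.
  by have [j <-] := bumpP _ il i1; move/rowP/(_ j): FG; rewrite !mxE.
pose c i : R[i] := if i == 1%N then 0 else
  if insub (unbump 1 i) is Some j then v ord0 j else 0.
pose Q := \poly_(i < 2 ^ n) c i.
have sQ : (size Q <= 2 ^ n)%N by exact: size_poly.
have sX : (size Q < size ('X^(2 ^ n) : {poly R[i]}))%N by rewrite size_polyXn.
exists ('X^(2 ^ n) + Q).
  split.
  - by rewrite monicE lead_coefDl // lead_coefXn.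
  - by rewrite size_polyDl // size_polyXn.
  - by apply/crit0; rewrite coefD coefXn coef_poly n1 /c eqxx (ltn_eqF n1) addr0.
apply/rowP => j; rewrite !mxE coefD coefXn coef_poly bump_lt (ltn_eqF (bump_lt j)).
rewrite add0r /c eq_sym (negbTE (neq_bump _ _)) bumpK insubT //=.
by move=> jl; congr (v _ _); apply: val_inj.
Qed.

Definition Pn_nd n : set {poly R[i]} :=
  [set F | Pn n F /\ (critical_points F #= `I_(2 ^ n - 1))%card].

Definition Bn n : set {poly R[i]} :=
  [set F | [/\ Pn_nd n F, (critical_values F #= `I_n)%card &
    exists L : nat -> set R[i],
      [/\ partition `I_n L (critical_points F),
          L 0%N = [set 0],
          (forall i, (i < n)%N -> (L i #= `I_(2 ^ i))%card) &
          (forall i, (i < n)%N ->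
             exists v, (fun z => F.[z]) @` L i = [set v])]]].

Definition quad_poly (a : R[i]) : {poly R[i]} := 'X^2 + a%:P.

(* [:: a_1; ...; a_n] is sent to P_{a_n} o ... o P_{a_1}. *)
Definition quad_comp (s : seq R[i]) : {poly R[i]} :=
  foldl (fun F a => quad_poly a \Po F) 'X s.

Definition Poln n : set {poly R[i]} :=
  [set F | exists2 s : seq R[i], size s = n & F = quad_comp s].

Definition Poln_nd n : set {poly R[i]} :=
  [set F | [/\ Poln n F, Pn_nd n F & (critical_values F #= `I_n)%card]].

End Polynomials.

(* Main.v *)
(* Near a polynomial F with distinct critical points, take as coordinates on
   the space of polynomials the nonzero critical points and the value at 0, or
   alternatively the critical values.  If a tangent vector G (a polynomial of
   degree less than deg F with G'(0) = 0) vanishes at all critical points, then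
   G is a multiple of F', hence zero since 0 is a simple root of F'; so the
   critical values are local coordinates.  In these coordinates B_n is given,
   near each of its points, by equalities between critical values: the
   partition cannot change, as distinct critical values stay distinct.

   A point of B_n close to Pol_n^nd lies in Pol_n by descent: the critical
   points in the last block L_{n-1} are double roots of F - v, so F = Q^2 + v,
   and Q has critical points L_0, ..., L_{n-2}.  On each of these blocks Q takes
   values w and -w only, and by continuity from the nearby element of Pol_n,
   where Q is constant and nonzero on the block, only one of them.

   Both coordinate maps f are polynomial, and their derivatives are explicit in
   Caratheodory's form f x - f y = (x - y) *m D (x, y) with D continuous; this
   makes f a small perturbation of the linear map D (p, p) near p, so that a
   contraction argument inverts it where D (p, p) is invertible. *)
Require Import Defs.
From mathcomp Require Import all_boot all_order all_algebra all_field.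
From mathcomp Require Import complex.
From mathcomp Require Import all_classical all_reals all_analysis.
From mathcomp Require Import finmap.
From mathcomp Require Import ring zify.
Import Order.TTheory GRing.Theory Num.Theory.
Import numFieldNormedType.Exports.
Set Implicit Arguments.
Unset Strict Implicit.
Unset Printing Implicit Defensive.
Local Open Scope classical_set_scope.
Local Open Scope ring_scope.

(** * Inverse function theorem *)

Section MatrixTopology.
Variable K : numFieldType.

Lemma ler_mx_coord m n (M : 'M[K]_(m, n)) i j : `|M i j| <= `|M|.
Proof.
(* Otherwise [M] would lie in the open ball around 0 whose radius is the norm of its own entry
   [M i j]; balls of matrices are described entry by entry. *)
rewrite real_leNgt ?normr_real //; apply/negP => lt.
have [_ /(_ i j)] : ball (0 : 'M[K]_(m, n)) `|M i j| M.
  by rewrite mx_norm_ball /ball_ /= sub0r normrN.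
by rewrite /ball /= mxE sub0r normrN ltxx.
Qed.

Lemma mx_norm_le m n (M : 'M[K]_(m, n)) e :
  0 <= e -> (forall i j, `|M i j| <= e) -> `|M| <= e.
Proof.
move=> e0 Me; rewrite [leLHS]/Num.norm /=.
have [->//|N0] := eqVneq (mx_norm M) 0.
by have [[i j] ->] := mx_norm_neq0 N0.
Qed.

Lemma ler_norm_mulmx m n p (A : 'M[K]_(m, n)) (B : 'M[K]_(n, p)) :
  `|A *m B| <= n%:R * `|A| * `|B|.
Proof.
apply: mx_norm_le => [|i j]; first by rewrite !mulr_ge0.
rewrite mxE (le_trans (ler_norm_sum _ _ _)) //.
rewrite (@le_trans _ _ (\sum_(k < n) `|A| * `|B|)) //; last first.
  by rewrite sumr_const card_ord -mulrA mulr_natl.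
by apply: ler_sum => k _; rewrite normrM ler_pM ?ler_mx_coord.
Qed.

Lemma cvg_mx (T : Type) (F : set_system T) {FF : Filter F} m n
    (f : T -> 'M[K]_(m, n)) (M : 'M[K]_(m, n)) :
  (forall i j, (fun t => f t i j) @ F --> M i j) -> f @ F --> M.
Proof.
move=> fM; apply/cvg_ballP => e e0.
have : \forall t \near F, forall i j, ball (M i j) e (f t i j).
  apply: filter_forall => i; apply: filter_forall => j.
  by have /cvg_ballP /(_ _ e0) := fM i j.
by apply: filterS => t.
Qed.

Lemma cvg_coord (T : Type) (F : set_system T) {FF : Filter F} m n
    (f : T -> 'M[K]_(m, n)) (M : 'M[K]_(m, n)) i j :
  f @ F --> M -> (fun t => f t i j) @ F --> M i j.
Proof. move=> fM.
exact: (@continuous_cvg _ _ _ F FF f (fun N : 'M[K]_(m, n) => N i j) M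
  (@coord_continuous K m n i j M) fM).
Qed.

Lemma cvg_bigsum (T I : Type) (F : set_system T) {FF : Filter F} (r : seq I)
    (P : pred I) (f : I -> T -> K) (l : I -> K) :
  (forall i, P i -> f i @ F --> l i) ->
  (fun t => \sum_(i <- r | P i) f i t) @ F --> \sum_(i <- r | P i) l i.
Proof.
move=> fl; elim: r => [|i r IH].
  by under eq_cvg do rewrite big_nil; rewrite big_nil; exact: cvg_cst.
under eq_cvg do rewrite big_cons; rewrite big_cons.
by case: ifP => // Pi; apply: cvgD => //; exact: fl.
Qed.

Lemma cvg_bigprod (T I : Type) (F : set_system T) {FF : Filter F} (r : seq I)
    (P : pred I) (f : I -> T -> K) (l : I -> K) :
  (forall i, P i -> f i @ F --> l i) ->
  (fun t => \prod_(i <- r | P i) f i t) @ F --> \prod_(i <- r | P i) l i.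
Proof.
move=> fl; elim: r => [|i r IH].
  by under eq_cvg do rewrite big_nil; rewrite big_nil; exact: cvg_cst.
under eq_cvg do rewrite big_cons; rewrite big_cons.
by case: ifP => // Pi; apply: cvgM => //; exact: fl.
Qed.

Lemma cvg_mulmx (T : Type) (F : set_system T) {FF : Filter F} m n p
    (f : T -> 'M[K]_(m, n)) (g : T -> 'M[K]_(n, p)) (A : 'M[K]_(m, n))
    (B : 'M[K]_(n, p)) :
  f @ F --> A -> g @ F --> B -> (fun t => f t *m g t) @ F --> A *m B.
Proof.
move=> fA gB; apply: cvg_mx => i j; rewrite mxE.
under eq_cvg do rewrite mxE.
by apply: cvg_bigsum => k _; apply: cvgM; exact: cvg_coord.
Qed.

Lemma cvg_det (T : Type) (F : set_system T) {FF : Filter F} n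
    (f : T -> 'M[K]_n) (A : 'M[K]_n) :
  f @ F --> A -> (fun t => \det (f t)) @ F --> \det A.
Proof.
move=> fA; rewrite /determinant; apply: cvg_bigsum => s _.
by apply: cvgM; [exact: cvg_cst|apply: cvg_bigprod => i _; exact: cvg_coord].
Qed.

Lemma cvg_adj (T : Type) (F : set_system T) {FF : Filter F} n
    (f : T -> 'M[K]_n) (A : 'M[K]_n) :
  f @ F --> A -> (fun t => \adj (f t)) @ F --> \adj A.
Proof.
move=> fA; apply: cvg_mx => i j; rewrite mxE.
under eq_cvg do rewrite mxE.
rewrite /cofactor; apply: cvgM; first exact: cvg_cst.
apply: cvg_det; apply: cvg_mx => a b; rewrite !mxE.
under eq_cvg do rewrite !mxE.
exact: cvg_coord.
Qed.

Lemma unitmx_near (T : Type) (F : set_system T) {FF : Filter F} n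
    (f : T -> 'M[K]_n) (A : 'M[K]_n) :
  f @ F --> A -> A \in unitmx -> \forall t \near F, f t \in unitmx.
Proof.
move=> /cvg_det fA; rewrite unitmxE unitfE => A0.
near=> t; rewrite unitmxE unitfE; near: t.
exact: (cvgr_neq0 _ fA A0).
Unshelve. all: by end_near. Qed.

(** Cramer's rule writes the inverse through the determinant and the adjugate, both polynomial in
    the entries. [invmx] obeys it only at invertible matrices, which is why [unitmx_near] is
    called. *)
Lemma cvg_invmx (T : Type) (F : set_system T) {FF : Filter F} n
    (f : T -> 'M[K]_n) (A : 'M[K]_n) :
  A \in unitmx -> f @ F --> A -> (fun t => invmx (f t)) @ F --> invmx A.
Proof.
move=> uA fA.
have : (fun t => (\det (f t))^-1 *: \adj (f t)) @ F --> invmx A.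
  rewrite /invmx uA; apply: cvgZ; last exact: cvg_adj.
  by apply: cvgV; [rewrite -unitfE -unitmxE|exact: cvg_det].
apply: cvg_trans; apply: near_eq_cvg.
near=> t; rewrite /invmx; suff -> : f t \in unitmx by [].
by near: t; exact: unitmx_near fA uA.
Unshelve. all: by end_near. Qed.

End MatrixTopology.

Lemma differentiable_of_linear_approx (K : numFieldType)
    (V W : normedModType K) (g : V -> W) (dg : {linear V -> W}) (p : V) :
  continuous dg ->
  (forall e, 0 < e ->
    \forall x \near p, `|g x - g p - dg (x - p)| <= e * `|x - p|) ->
  differentiable g p.
Proof.
move=> dgc H.
have gE : g \o shift p = cst (g p) + dg +o_ 0 id.
  apply/eqaddoP => e e0; rewrite near_simpl /=.
  have := H _ e0; rewrite (near_shift 0) subr0; apply: filterS => x /=.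
  by rewrite addrK opprD addrA.
by apply/diff_locallyP; rewrite (diff_unique dgc gE).
Qed.

(** * Local inversion by contraction *)

Section InverseFunction.
Variable K : numFieldType.

(** Completeness in the form that a contraction calls for: geometrically decreasing steps force
    convergence. *)
Definition geometric_complete :=
  forall (u : nat -> K) (C : K),
    (forall k, `|u k.+1 - u k| <= C / 2 ^+ k) -> exists l : K, u @ \oo --> l.

Hypothesis Kc : geometric_complete.
Variable N : nat.
Variables (f : 'rV[K]_N -> 'rV[K]_N).
Variables (D : 'rV[K]_N * 'rV[K]_N -> 'M[K]_N).
Hypothesis fD : forall x y, f x - f y = (x - y) *m D (x, y).

Lemma slope_image_nbhs (p : 'rV[K]_N) (W : set 'rV[K]_N) :
  {for (p, p), continuous D} -> D (p, p) \in unitmx ->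
  nbhs p W -> nbhs (f p) (f @` W).
Proof.
move=> Dc uD Wp; set A := D (p, p); set B := invmx A.
pose E z := 1%:M - D z *m B.
have E0 : E @ (p, p) --> (0 : 'M[K]_N).
  have : E @ (p, p) --> (1%:M - D (p, p) *m B : 'M[K]_N).
    apply: (@cvgB _ _ _ (nbhs (p, p)) _ (fun=> 1%:M) (fun z => D z *m B)).
      exact: cvg_cst.
    by apply: cvg_mulmx; [exact: Dc|exact: cvg_cst].
  by rewrite mulmxV // subrr.
(* In the sup norm a matrix product costs a factor [N], so under this bound multiplication by [E z]
   at least halves norms. The successor keeps the constant positive when [N = 0]. *)
have e0 : 0 < (2 * N.+1%:R)^-1 :> K by rewrite invr_gt0 mulr_gt0.
have Esmall : \forall z \near (p, p), `|E z| < (2 * N.+1%:R)^-1.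
  by move/cvgr0_norm_lt/(_ _ e0) : E0.
have : \forall z \near (p, p), W z.1 /\ `|E z| < (2 * N.+1%:R)^-1.
  near=> z; split; near: z => //.
  by exists (W, setT) => //=; [split => //; exact: filterT|move=> [a b] []].
move=> /nbhs_ballP[r /= r0 Hr].
have ballW (x : 'rV[K]_N) : `|p - x| < r -> W x.
  move=> xr; have [] // := Hr (x, p).
  by split; [rewrite -ball_normE|exact: ballxx].
have ballE (x y u : 'rV[K]_N) : `|p - x| < r -> `|p - y| < r ->
    `|u *m E (x, y)| <= `|u| / 2.
  move=> xr yr; have [_ /ltW Exy] : W x /\ `|E (x, y)| < (2 * N.+1%:R)^-1.
    by apply: (Hr (x, y)); split; rewrite -ball_normE.
  rewrite (le_trans (ler_norm_mulmx _ _)) //.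
  apply: (@le_trans _ _ (N%:R * `|u| * (2 * N.+1%:R)^-1)).
    by rewrite ler_wpM2l ?mulr_ge0.
  rewrite invfM (mulrC N%:R) -mulrA (mulrCA N%:R).
  by rewrite [leLHS]mulrA ler_piMr ?divr_ge0// ler_pdivrMr // mul1r ler_nat.
(* With a first step below [r / 4] and ratio one half, the steps add up to at most [r / 2], so that
   the iterates and their limit stay in the ball. *)
have V : \forall y \near f p, `|(y - f p) *m B| < r / 4.
  have : (fun y => (y - f p) *m B) @ f p --> (0 : 'rV[K]_N).
    have : (fun y => (y - f p) *m B) @ f p --> (f p - f p) *m B.
      apply: (@cvg_mulmx K _ (nbhs (f p)) _ _ _ _ (fun y => y - f p) (fun=> B)).
        2: by apply: cvg_cst.
      by apply: (@cvgB _ _ _ (nbhs (f p)) _ id (fun=> f p));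
        [exact: cvg_id|exact: cvg_cst].
    by rewrite subrr mul0mx.
  have r4 : 0 < r / 4 by rewrite divr_gt0.
  by move/cvgr0_norm_lt/(_ _ r4).
near=> y; have yV : `|(y - f p) *m B| < r / 4 by near: y.
pose g x := x + (y - f x) *m B.
have gE x x' : g x - g x' = (x - x') *m E (x, x').
  rewrite /g /E mulmxBr mulmx1 mulmxA -fD.
  rewrite opprD addrACA -mulmxBl; congr (_ + _).
  by rewrite -mulNmx; congr (_ *m _); rewrite opprB addrC addrA subrK opprB.
pose x k := iter k g p.
have rk k : r / 2 * (1 - (2 ^+ k)^-1) < r.
  rewrite -mulrA gtr_pMr // mulrC ltr_pdivrMr // mul1r.
  by rewrite ltrBlDr (@lt_trans _ _ 2) ?ltrDl ?ltr1n.
(* Both bounds go through one induction: the contraction estimate for the next step requires the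
   iterates to be in the ball. *)
have xk k : `|x k.+1 - x k| <= r / 4 / 2 ^+ k /\
    `|p - x k| <= r / 2 * (1 - (2 ^+ k)^-1).
  elim: k => [|k [IH1 IH2]].
    rewrite expr0 invr1 (subrr 1) mulr0 mulr1 /x /= subrr normr0.
    by split=> //; rewrite /g addrC addKr ltW.
  have IH3 : `|p - x k.+1| <= r / 2 * (1 - (2 ^+ k.+1)^-1).
    rewrite -[p](subrK (x k)) -addrA (le_trans (ler_normD _ _)) //.
    rewrite (distrC (x k)); apply: (le_trans (lerD IH2 IH1)).
    by rewrite exprSr invfM le_eqVlt; apply/orP; left; apply/eqP; field;
       rewrite expf_neq0.
  split=> //; rewrite {1}/x [iter k.+2 g p]/(g (x k.+1)).
  rewrite -[X in _ - X]/(g (x k)) gE (le_trans (ballE _ _ _ _ _)) //.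
  - exact: le_lt_trans IH3 (rk _).
  - exact: le_lt_trans IH2 (rk _).
  - by rewrite exprSr invfM mulrA ler_wpM2r.
have [l xl] : exists l : 'rV[K]_N, x @ \oo --> l.
  have lj j : exists lj : K, (fun k => x k ord0 j : K) @ \oo --> lj.
    apply: (@Kc _ (r / 4)) => k; rewrite (le_trans _ (xk k).1) //.
    by rewrite (le_trans _ (ler_mx_coord _ ord0 j)) // !mxE.
  have [l ll] := choice lj; exists (\row_j l j).
  by apply: cvg_mx => i j; rewrite mxE (ord1 i); exact: ll.
have lr : `|p - l| < r.
  have /cvgrPdist_lt/(_ (r / 2)) := xl.
  move=> /(_ (divr_gt0 r0 (ltr0Sn _ _))) /filter_ex[k lk].
  rewrite -[p](subrK (x k)) -addrA (le_lt_trans (ler_normD _ _)) //.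
  rewrite [ltRHS]splitr ler_ltD //; last by rewrite distrC.
  rewrite (le_trans (xk k).2) // ler_piMr ?divr_ge0 ?(ltW r0) //.
have gl : g l = l.
  apply/eqP; rewrite -subr_eq0 -normr_le0; apply/ler_addgt0Pl => e ep.
  rewrite addr0.
  have xl1 : (fun k => x k.+1) @ \oo --> l by rewrite cvg_shiftS.
  have /cvgrPdist_lt/(_ (e / 2) (divr_gt0 ep (ltr0Sn _ _))) := xl.
  have /cvgrPdist_lt/(_ (e / 2) (divr_gt0 ep (ltr0Sn _ _))) := xl1.
  move=> h1 h2; have [k [k1 k2]] := filter_ex (filterI h1 h2).
  rewrite -[g l](subrK (x k.+1)) -addrA (le_trans (ler_normD _ _)) //.
  rewrite [leRHS]splitr lerD //; last by rewrite distrC ltW.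
  rewrite -[x k.+1]/(g (x k)) gE (le_trans (ballE _ _ _ _ _)) //.
    exact: le_lt_trans (xk k).2 (rk _).
  by rewrite (le_trans _ (ltW k2)) // ler_pdivrMr // ler_peMr // ler1n.
exists l; first exact: ballW.
have : (y - f l) *m B = 0 by move/(canRL (addKr l)) : gl; rewrite addNr.
by move/(congr1 (mulmx^~ A)); rewrite mulmxKV // mul0mx => /subr0_eq.
Unshelve. all: by end_near. Qed.

(** Carathéodory's criterion; the differential is right multiplication by [G p], with error
    [(x - p) *m (G x - G p)]. *)
Lemma slope_differentiable (g : 'rV[K]_N -> 'rV[K]_N) (G : 'rV[K]_N -> 'M[K]_N)
    (p : 'rV[K]_N) :
  (\forall x \near p, g x - g p = (x - p) *m G x) -> {for p, continuous G} ->
  differentiable g p.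
Proof.
move=> gG Gc.
have lc : continuous (mulmxr (G p) : 'rV[K]_N -> 'rV[K]_N).
  move=> x; apply: (@cvg_mulmx K _ (nbhs x) _ _ _ _ id (fun=> G p)).
    exact: cvg_id.
  exact: cvg_cst.
apply: (differentiable_of_linear_approx lc) => e e0.
have e1 : 0 < e / N.+1%:R by rewrite divr_gt0.
have Gsmall : \forall x \near p, `|G x - G p| <= e / N.+1%:R.
  by move/cvgrPdistC_le : Gc => /(_ _ e1).
near=> x; have -> : g x - g p = (x - p) *m G x by near: x.
rewrite /= -mulmxBr (le_trans (ler_norm_mulmx _ _)) //.
apply: (@le_trans _ _ (N%:R * `|x - p| * (e / N.+1%:R))).
  by rewrite ler_wpM2l ?mulr_ge0 //; near: x.
rewrite mulrAC ler_wpM2r // mulrCA ler_piMr ?(ltW e0) //.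
by rewrite ler_pdivrMr // mul1r ler_nat.
Unshelve. all: by end_near. Qed.

Lemma slope_continuousl (x0 : 'rV[K]_N) (T : Type) (F : set_system T)
    {FF : Filter F} (h : T -> 'rV[K]_N) (a : 'rV[K]_N) :
  {for (a, x0), continuous D} -> h @ F --> a ->
  (fun t => D (h t, x0)) @ F --> D (a, x0).
Proof.
move=> Dc ha; have hx : (fun t => (h t, x0)) @ F --> (a, x0).
  apply: (@cvg_pair _ _ _ F (nbhs a) (nbhs x0) _ _ _ h (fun=> x0)) => //.
  exact: cvg_cst.
exact: (@continuous_cvg _ _ _ F FF _ D _ Dc hx).
Qed.

(** On a ball where all slopes are invertible, the slope identity gives injectivity,
    [slope_image_nbhs] gives openness, and the inverse has the inverse slopes. The conclusion ranges
    over all open [U] in [W] so that two such inversions can be restricted to a common domain. *)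
Lemma slope_local_inverse (p : 'rV[K]_N) :
  continuous D -> D (p, p) \in unitmx ->
  exists W psi, [/\ open W, W p & forall U : set 'rV[K]_N, open U -> U `<=` W ->
    [/\ open (f @` U), forall x, U x -> differentiable f x,
        forall y, (f @` U) y -> differentiable psi y &
        forall x, U x -> psi (f x) = x]].
Proof.
move=> Dc uD.
have : \forall z \near (p, p), D z \in unitmx by exact: unitmx_near (Dc _) uD.
move=> /nbhs_ballP[r /= r0 Hr]; pose W := ball p r.
have uW x y : W x -> W y -> D (x, y) \in unitmx.
  by move=> Wx Wy; apply: (Hr (x, y)); split.
have oW : open W by exact: ball_open.
have finj x y : W x -> W y -> f x = f y -> x = y.
  move=> Wx Wy /eqP; rewrite -subr_eq0 fD => /eqP.
  move/(congr1 (mulmx^~ (invmx (D (x, y))))).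
  by rewrite mulmxK ?uW // mul0mx => /subr0_eq.
pose psi y := xget p [set x | W x /\ f x = y].
have psiK x : W x -> psi (f x) = x.
  rewrite /psi => Wx; case: xgetP => [z _ [Wz /finj]|/(_ x)]; first exact.
  by case.
have imn x (A : set 'rV[K]_N) : W x -> nbhs x A -> nbhs (f x) (f @` A).
  by move=> Wx; apply: slope_image_nbhs; [exact: Dc|exact: uW].
(* Continuity of the inverse is openness of [f]. *)
have psic x : W x -> psi @ f x --> x.
  move=> Wx A Ax; have : nbhs (f x) (f @` (A `&` W)).
    by apply: imn => //; apply: filterI => //; exact: open_nbhs_nbhs.
  by apply: filterS => _ [z [Az Wz] <-] /=; rewrite psiK.
exists W, psi; split => //; first exact: ballxx.
move=> U oU UW; split.
- rewrite openE => _ [x Ux <-]; apply: imn; first exact: UW.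
  exact: open_nbhs_nbhs.
- move=> x Ux; apply: (@slope_differentiable _ (fun y => D (y, x))).
    by near=> y; exact: fD.
  by apply: (@slope_continuousl x _ (nbhs x) _ id x); [exact: Dc|exact: cvg_id].
- move=> _ [x Ux <-]; have Wx := UW _ Ux.
  apply: (@slope_differentiable _ (fun y => invmx (D (psi y, x)))).
    have : nbhs (f x) (f @` W).
      by apply: imn => //; exact: open_nbhs_nbhs.
    by apply: filterS => _ [z Wz <-]; rewrite !psiK // fD mulmxK ?uW.
  rewrite /prop_for /continuous_at psiK //.
  apply: (@cvg_invmx K _ (nbhs (f x)) _ _ (fun y => D (psi y, x))).
    exact: uW.
  by apply: slope_continuousl; [exact: Dc|exact: psic].
- by move=> x Ux; rewrite psiK //; exact: UW.
Unshelve. all: by end_near. Qed.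

End InverseFunction.

(** * Completeness of the complex numbers *)

Section ComplexCompleteness.
Local Open Scope complex_scope.

(** The sequence is the sum of its increments, a series dominated by a geometric one. *)
Lemma real_geometric_cvg (R : realType) (a : R^nat) (c : R) :
  (forall k, `|a k.+1 - a k| <= c / 2 ^+ k) -> cvgn a.
Proof.
move=> ac.
have tel : a = (fun n => a 0%N + series (telescope a) n).
  by apply/funext => n; rewrite seriesEnat /= telescope_sumr // addrC subrK.
rewrite tel; apply: is_cvgD; first exact: is_cvg_cst.
apply: normed_cvg.
apply: (@series_le_cvg _ _ (geometric c (2^-1))) => [k|k|k|].
- exact: normr_ge0.
- rewrite /= mulr_ge0 ?exprn_ge0 //.
  by have := ac 0%N; rewrite expr0 divr1; apply: le_trans.
- by rewrite /= exprVn; exact: ac.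
- apply: is_cvg_geometric_series.
  by rewrite ger0_norm // invf_lt1 // ltr1n.
Qed.

Lemma complex_geometric_complete (R : realType) : geometric_complete R[i].
Proof.
move=> u C uC.
(* The order of [R[i]] compares only numbers with equal imaginary parts, so an upper bound of a norm
   is real. *)
have [c cE] : exists c : R, C = c%:C.
  have := uC 0%N; rewrite expr0 divr1 => /(le_trans (normr_ge0 _)).
  by rewrite lecE => /andP[/eqP C0 _]; exists (complex.Re C);
    case: C C0 {uC} => a b /= ->.
have uc k : `|u k.+1 - u k| <= (c / 2 ^+ k)%:C.
  by rewrite rmorphM fmorphV rmorphXn rmorph_nat /= -cE.
have ReB (z w : R[i]) : complex.Re (z - w) = complex.Re z - complex.Re w.
  by rewrite raddfB.
have ImB (z w : R[i]) : complex.Im (z - w) = complex.Im z - complex.Im w.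
  by rewrite raddfB.
have nRe (z : R[i]) d : `|z| <= d%:C -> `|complex.Re z| <= d.
  case: z => x y; rewrite normc_def lecR /=; apply: le_trans.
  by rewrite -sqrtr_sqr ler_wsqrtr // lerDl sqr_ge0.
have nIm (z : R[i]) d : `|z| <= d%:C -> `|complex.Im z| <= d.
  case: z => x y; rewrite normc_def lecR /=; apply: le_trans.
  by rewrite -sqrtr_sqr ler_wsqrtr // lerDr sqr_ge0.
have Rec : cvgn (fun k => complex.Re (u k)).
  by apply: (@real_geometric_cvg _ _ c) => k; rewrite -ReB nRe.
have Imc : cvgn (fun k => complex.Im (u k)).
  by apply: (@real_geometric_cvg _ _ c) => k; rewrite -ImB nIm.
set a := limn _ in Rec; set b := limn _ in Imc.
exists (a +i* b); apply/cvgrPdist_lt => e e0.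
have [d d0 ->] : exists2 d : R, 0 < d & e = d%:C.
  move: e0; rewrite ltcE => /andP[/eqP C0 e0].
  by exists (complex.Re e) => //; case: e C0 {e0} => x y /= ->.
have d2 : 0 < d / 2 by rewrite divr_gt0.
near=> k.
have -> : a +i* b - u k =
    (a - complex.Re (u k)) +i* 0 + 0 +i* (b - complex.Im (u k)).
  by case: (u k) => x y; apply/eqP; rewrite eq_complex /= addr0 add0r !eqxx.
rewrite (le_lt_trans (ler_normD _ _)) // [d]splitr rmorphD ltrD // normc_def /=.
  rewrite expr0n addr0 sqrtr_sqr ltcR.
  by near: k; move/cvgrPdist_lt/(_ _ d2) : Rec.
rewrite expr0n add0r sqrtr_sqr ltcR.
by near: k; move/cvgrPdist_lt/(_ _ d2) : Imc.
Unshelve. all: by end_near. Qed.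

End ComplexCompleteness.

(** * Polynomials parametrized by their critical points *)

(** The factors are exchanged one at a time. This yields slopes for a product of linear factors in
    terms of its roots. *)
Lemma prodrB_telescope (A : comNzRingType) n (a b : 'I_n -> A) :
  \prod_i a i - \prod_i b i =
  \sum_k (a k - b k) * \prod_(j | j != k) (if (j < k)%N then a j else b j).
Proof.
elim: n a b => [|n IH] a b; first by rewrite !big_ord0 subrr.
rewrite !big_ord_recr /=.
have -> : \prod_(i < n.+1 | i != ord_max) (if (i < n)%N then a i else b i) =
    \prod_(i < n) a (widen_ord (leqnSn n) i).
  rewrite big_mkcond big_ord_recr /= eqxx mulr1; apply: eq_bigr => i _.
  by rewrite ltn_ord -val_eqE /= ltn_eqF.
set pa := \prod_(i < n) _; set pb := \prod_(i < n) _.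
have -> : pa * a ord_max - pb * b ord_max =
    (pa - pb) * b ord_max + (a ord_max - b ord_max) * pa by ring.
congr (_ + _); rewrite IH mulr_suml; apply: eq_bigr => k _.
rewrite -mulrA; congr (_ * _).
rewrite [RHS]big_mkcond big_ord_recr /= -big_mkcond /=; congr (_ * _).
by rewrite -val_eqE /= gtn_eqF // ltnNge ltnW.
Qed.

(** * Primitives and difference quotients of polynomials *)

Section Primitive.
Variable K : numFieldType.
Implicit Types p q : {poly K}.

(* The constant term vanishes because [0^-1 = 0]. *)
Definition primitive p : {poly K} :=
  \poly_(i < (size p).+1) (p`_i.-1 / i%:R).

Lemma coef_primitive p i : (primitive p)`_i = p`_i.-1 / i%:R.
Proof.
rewrite coef_poly; case: ltnP => // pi.
by case: i pi => // i pi; rewrite nth_default ?mul0r.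
Qed.

Lemma size_primitive p m : (size p <= m)%N -> (size (primitive p) <= m.+1)%N.
Proof. by move=> pm; rewrite (leq_trans (size_poly _ _)). Qed.

Lemma deriv_primitive p : (primitive p)^`() = p.
Proof.
apply/polyP => i; rewrite coef_deriv coef_primitive /= -[LHS]mulr_natr.
by rewrite divfK.
Qed.

Lemma primitiveB p q : primitive (p - q) = primitive p - primitive q.
Proof. by apply/polyP => i; rewrite !(coef_primitive, coefB) mulrBl. Qed.

Lemma primitiveZ c p : primitive (c *: p) = c *: primitive p.
Proof. by apply/polyP => i; rewrite !(coef_primitive, coefZ) mulrA. Qed.

Lemma primitive_sum (I : Type) (r : seq I) (P : pred I) (F : I -> {poly K}) :
  primitive (\sum_(i <- r | P i) F i) = \sum_(i <- r | P i) primitive (F i).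
Proof.
apply/polyP => m; rewrite coef_primitive !coef_sum mulr_suml.
by apply: eq_bigr => i _; rewrite coef_primitive.
Qed.

Lemma deriv_eq0 p : p^`() = 0 -> p = (p`_0)%:P.
Proof.
move=> p0; apply/polyP => -[|i]; rewrite coefC //=.
move/polyP/(_ i) : p0; rewrite coef_deriv coef0 => /eqP.
by rewrite mulrn_eq0 /= => /eqP.
Qed.

(* Meaningful for polynomials of size at most [m]; a fixed bound makes the
   continuity in the coefficients obvious. *)
Definition horner_slope m p (a b : K) :=
  \sum_(i < m) p`_i * \sum_(l < i) a ^+ (i.-1 - l) * b ^+ l.

Lemma horner_slopeP m p a b : (size p <= m)%N ->
  p.[a] - p.[b] = (a - b) * horner_slope m p a b.
Proof.
move=> pm; rewrite !(horner_coef_wide _ pm) -sumrB mulr_sumr.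
by apply: eq_bigr => i _; rewrite -mulrBr subrXX mulrCA.
Qed.

Lemma horner_slope_diag m p a : (size p <= m)%N ->
  horner_slope m p a a = p^`().[a].
Proof.
case: m => [|m] pm.
  move: pm; rewrite leqn0 size_poly_eq0 => /eqP ->.
  by rewrite /horner_slope big_ord0 deriv0 horner0.
have dm : (size p^`() <= m)%N.
  by rewrite (leq_trans (size_poly _ _)) //; case: (size p) pm.
rewrite (horner_coef_wide _ dm) /horner_slope big_ord_recl /=.
rewrite big_ord0 mulr0 add0r.
apply: eq_bigr => i _; rewrite coef_deriv.
rewrite (eq_bigr (fun=> a ^+ i)) => [|l _].
  by rewrite sumr_const card_ord /bump /= add1n mulrnAl mulrnAr.
by rewrite -exprD subnK // -ltnS.
Qed.

End Primitive.

Section PolyContinuity.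
Variables (K : numFieldType) (T : topologicalType).
Implicit Types p q : T -> {poly K}.

(** Continuity coefficient by coefficient; to pass to values, [continuous_horner_coef] adds a
    uniform bound on the sizes. *)
Definition coef_continuous p := forall m, continuous (fun t => (p t)`_m : K).

Lemma coef_continuous_cst (p : {poly K}) : coef_continuous (fun=> p).
Proof. by move=> m t; exact: cvg_cst. Qed.

Lemma coef_continuousC (c : T -> K) : continuous c ->
  coef_continuous (fun t => (c t)%:P).
Proof.
move=> cc [|m] t; rewrite /continuous_at;
  under eq_cvg do rewrite coefC /=; rewrite coefC /=.
  exact: cc.
exact: cvg_cst.
Qed.

Lemma coef_continuousD p q : coef_continuous p -> coef_continuous q ->
  coef_continuous (fun t => p t + q t).
Proof.
move=> pc qc m t; rewrite /continuous_at.
under eq_cvg do rewrite coefD; rewrite coefD.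
by apply: cvgD; [exact: pc|exact: qc].
Qed.

Lemma coef_continuousZ (c : K) p : coef_continuous p ->
  coef_continuous (fun t => c *: p t).
Proof.
move=> pc m t; rewrite /continuous_at.
under eq_cvg do rewrite coefZ; rewrite coefZ.
by apply: cvgM; [exact: cvg_cst|exact: pc].
Qed.

Lemma coef_continuousM p q : coef_continuous p -> coef_continuous q ->
  coef_continuous (fun t => p t * q t).
Proof.
move=> pc qc m t; rewrite /continuous_at.
under eq_cvg do rewrite coefM; rewrite coefM.
by apply: cvg_bigsum => i _; apply: cvgM; [exact: pc|exact: qc].
Qed.

Lemma coef_continuous_prod (I : Type) (r : seq I) (P : pred I)
    (p : I -> T -> {poly K}) : (forall i, P i -> coef_continuous (p i)) ->
  coef_continuous (fun t => \prod_(i <- r | P i) p i t).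
Proof.
move=> pc; elim: r => [|i r IH].
  move=> m t; rewrite /continuous_at.
under eq_cvg do rewrite big_nil; rewrite big_nil.
  exact: coef_continuous_cst.
move=> m t; rewrite /continuous_at.
under eq_cvg do rewrite big_cons; rewrite big_cons.
case: ifP => Pi; last exact: IH.
by apply: (coef_continuousM _ IH); exact: pc.
Qed.

Lemma coef_continuous_primitive p : coef_continuous p ->
  coef_continuous (fun t => primitive (p t)).
Proof.
move=> pc m t; rewrite /continuous_at.
under eq_cvg do rewrite coef_primitive; rewrite coef_primitive.
by apply: cvgM; [exact: pc|exact: cvg_cst].
Qed.

Lemma continuous_exprn (c : T -> K) k : continuous c ->
  continuous (fun t => c t ^+ k).
Proof.
move=> cc t; elim: k => [|k IH]; first exact: (cvg_cst (1 : K)).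
rewrite /continuous_at.
under eq_cvg do rewrite exprS; rewrite exprS.
by apply: cvgM => //; exact: cc.
Qed.

Lemma continuous_horner_coef m p (c : T -> K) :
  (forall t, size (p t) <= m)%N -> coef_continuous p -> continuous c ->
  continuous (fun t => (p t).[c t]).
Proof.
move=> sp pc cc t; rewrite /continuous_at.
under eq_cvg do rewrite (horner_coef_wide _ (sp _)).
rewrite (horner_coef_wide _ (sp _)); apply: cvg_bigsum => i _.
by apply: cvgM; [exact: pc|exact: continuous_exprn].
Qed.

Lemma continuous_horner_slope m p (a b : T -> K) :
  coef_continuous p -> continuous a -> continuous b ->
  continuous (fun t => horner_slope m (p t) (a t) (b t)).
Proof.
move=> pc ac bc t; apply: cvg_bigsum => i _; apply: cvgM; first exact: pc.
by apply: cvg_bigsum => l _; apply: cvgM; exact: continuous_exprn.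
Qed.

End PolyContinuity.

Lemma unitmx_inj (K : fieldType) n (A : 'M[K]_n) :
  (forall v : 'rV_n, v *m A = 0 -> v = 0) -> A \in unitmx.
Proof.
move=> Ainj; rewrite -row_free_unit -kermx_eq0; apply/eqP/row_matrixP => i.
by rewrite row0; apply: Ainj; rewrite -row_mul mulmx_ker row0.
Qed.

(** * Coefficients and critical values as functions of the critical points *)

Section CriticalPointFamily.
Variables (K : numFieldType) (N : nat) (i0 : 'I_N).
Implicit Types (x y v : 'rV[K]_N).

(* A vector [x] encodes the polynomial whose critical points are [0] and the
   [x 0 i], [i != i0], and whose value at [0] is [x 0 i0]. *)
Definition crit x i : K := if i == i0 then 0 else x 0 i.

Lemma crit0 x : crit x i0 = 0. Proof. by rewrite /crit eqxx. Qed.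

Lemma critE x i : i != i0 -> crit x i = x 0 i.
Proof. by rewrite /crit => /negbTE ->. Qed.

Definition crit_prod x : {poly K} := \prod_i ('X - (crit x i)%:P).

(** The factor [N.+1%:R] makes the primitive monic, and its vanishing constant term makes [x 0 i0]
    the value at 0. *)
Definition crit_poly x : {poly K} :=
  primitive (N.+1%:R *: crit_prod x) + (x 0 i0)%:P.

(** Difference quotient of [crit_poly] in the coordinate [k]: the coordinate [i0] is an additive
    constant, and the others come from the telescoped product. *)
Definition poly_slope (k : 'I_N) x y : {poly K} :=
  if k == i0 then 1 else
  - N.+1%:R *: primitive
      (\prod_(j | j != k)
         (if (j < k)%N then 'X - (crit x j)%:P else 'X - (crit y j)%:P)).

Lemma crit_polyB x y :
  crit_poly x - crit_poly y = \sum_k (x 0 k - y 0 k) *: poly_slope k x y.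
Proof.
rewrite /crit_poly opprD addrACA -primitiveB -scalerBr prodrB_telescope.
rewrite (bigD1 i0) //= [in RHS](bigD1 i0) //= !crit0 subrr mul0r add0r.
rewrite addrC -polyCB -alg_polyC {1}/poly_slope eqxx; congr (_ + _).
rewrite primitiveZ primitive_sum scaler_sumr; apply: eq_bigr => k ki0.
rewrite /poly_slope (negbTE ki0) opprB addrC addrA subrK -polyCB !critE //.
rewrite mul_polyC primitiveZ !scalerA; congr (_ *: _).
by rewrite mulrN -mulNr opprB mulrC.
Qed.

Lemma deriv_crit_poly x : (crit_poly x)^`() = N.+1%:R *: crit_prod x.
Proof. by rewrite derivD deriv_primitive derivC addr0. Qed.

Lemma crit_prodE x :
  crit_prod x = \prod_(z <- [seq crit x i | i <- enum 'I_N]) ('X - z%:P).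
Proof. by rewrite big_map big_enum. Qed.

Lemma size_crit_prod x : size (crit_prod x) = N.+1.
Proof.
by rewrite size_prod_XsubC [index_enum _]unlock -enumT size_enum_ord.
Qed.

Lemma size_crit_poly_le x : (size (crit_poly x) <= N.+2)%N.
Proof.
rewrite (leq_trans (size_polyD _ _)) // geq_max.
rewrite size_primitive ?(leq_trans (size_scale_leq _ _)) ?size_crit_prod //.
by rewrite (leq_trans (size_polyC_leq1 _)).
Qed.

Lemma coef_crit_polyN x : (crit_poly x)`_N.+1 = 1.
Proof.
rewrite coefD coef_primitive coefC addr0 /= coefZ.
have /monicP : crit_prod x \is monic by exact: monic_prod_XsubC.
by rewrite lead_coefE size_crit_prod /= => ->; rewrite mulr1 divff ?pnatr_eq0.
Qed.

Lemma size_crit_poly x : size (crit_poly x) = N.+2.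
Proof.
apply/eqP; rewrite eqn_leq size_crit_poly_le ltnNge; apply/negP => sN.
by have := coef_crit_polyN x; rewrite nth_default // => /esym/eqP;
  rewrite oner_eq0.
Qed.

Lemma crit_poly_monic x : crit_poly x \is monic.
Proof. by apply/monicP; rewrite lead_coefE size_crit_poly coef_crit_polyN. Qed.

Lemma root_deriv_crit_poly x z :
  root (crit_poly x)^`() z = [exists i, z == crit x i].
Proof.
rewrite deriv_crit_poly rootZ ?pnatr_eq0 // crit_prodE root_prod_XsubC.
apply/mapP/existsP => [[i _ ->]|[i /eqP ->]]; first by exists i.
by exists i => //; rewrite mem_enum.
Qed.

Lemma crit_poly_surj (F : {poly K}) x :
  F \is monic -> size F = N.+2 -> F^`() = N.+1%:R *: crit_prod x ->
  F`_0 = x 0 i0 -> F = crit_poly x.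
Proof.
move=> mF sF dF F0; apply/eqP; rewrite -subr_eq0.
have /deriv_eq0 -> : (F - crit_poly x)^`() = 0.
  by rewrite derivB dF deriv_crit_poly subrr.
rewrite coefB coefD coef_primitive coefC /= F0 invr0 mulr0 add0r.
by rewrite subrr polyC0.
Qed.

(** The tangent vector G: the derivative of [crit_poly] at [x] in the direction [v]. *)
Definition diag_slope v x : {poly K} := \sum_k v 0 k *: poly_slope k x x.

Lemma deriv_poly_slope k x : (poly_slope k x x)^`() =
  if k == i0 then 0 else - N.+1%:R *: \prod_(j | j != k) ('X - (crit x j)%:P).
Proof.
rewrite /poly_slope; case: ifP => _; first by rewrite derivC.
by rewrite derivZ deriv_primitive; under eq_bigr do rewrite if_same.
Qed.

Lemma size_poly_slope k x y : (size (poly_slope k x y) <= N.+1)%N.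
Proof.
rewrite /poly_slope; case: ifP => _; first by rewrite size_poly1.
rewrite (leq_trans (size_scale_leq _ _)) // size_primitive //.
rewrite (eq_bigr (fun j : 'I_N =>
  'X - (if (j < k)%N then crit x j else crit y j)%:P)).
  rewrite -big_filter size_prod_XsubC size_filter -sum1_count.
  have -> : (\sum_(j < N | j != k) 1 = #|predC1 k|)%N by rewrite -sum1_card.
  by rewrite cardC1 card_ord prednK // (leq_trans _ (ltn_ord k)).
by move=> j _; case: ifP.
Qed.

Lemma size_diag_slope v x : (size (diag_slope v x) <= N.+1)%N.
Proof.
apply: (leq_trans (size_sum _ _ _)); apply/bigmax_leqP => k _.
by rewrite (leq_trans (size_scale_leq _ _)) ?size_poly_slope.
Qed.

(** Every term other than the [k]-th keeps the factor vanishing at [crit x k]. With F =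
    [crit_poly x] and [c = crit x k], the result for [k != i0] is G'(c) = - F''(c) [v 0 k], the
    relation obtained by differentiating F'(c) = 0. *)
Lemma deriv_diag_slope_crit v x (k : 'I_N) : (diag_slope v x)^`().[crit x k] =
  if k == i0 then 0 else
  - N.+1%:R * v 0 k * \prod_(j | j != k) (crit x k - crit x j).
Proof.
rewrite raddf_sum /= horner_sum (bigD1 k) //= big1 ?addr0 => [|j jk].
  rewrite derivZ deriv_poly_slope; case: ifP => _.
    by rewrite scaler0 horner0.
  rewrite !hornerZ horner_prod mulrA (mulrC (v 0 k)); congr (_ * _).
  by apply: eq_bigr => j _; rewrite hornerXsubC.
rewrite derivZ deriv_poly_slope; case: ifP => _.
    by rewrite scaler0 horner0.
rewrite !hornerZ horner_prod (bigD1 k) 1?eq_sym //= hornerXsubC subrr.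
by rewrite mul0r !mulr0.
Qed.

Lemma diag_slope_inj v x : injective (crit x) -> diag_slope v x = 0 -> v = 0.
Proof.
move=> ci G0.
have vk k : k != i0 -> v 0 k = 0.
  move=> ki0; have := deriv_diag_slope_crit v x k.
  rewrite G0 deriv0 horner0 (negbTE ki0) => /esym/eqP.
  rewrite !mulf_eq0 oppr_eq0 pnatr_eq0 /= => /orP[/eqP //|].
  by rewrite prodf_seq_eq0 => /hasP[j _ /andP[jk]];
    rewrite subr_eq0 => /eqP/ci/eqP; rewrite eq_sym (negbTE jk).
apply/rowP => k; rewrite mxE; have [->|] := eqVneq k i0; last exact: vk.
move: G0; rewrite /diag_slope (bigD1 i0) //= big1 => [|j ji0]; last first.
  by rewrite vk // scale0r.
rewrite addr0 /poly_slope eqxx => /(congr1 (fun p : {poly K} => p.[0])).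
by rewrite hornerZ hornerC horner0 mulr1.
Qed.

(** G has degree at most [N] and [N] distinct roots, so it is a scalar multiple of [crit_prod x];
    since 0 is a simple root of that product, G'(0) = 0 forces the scalar to vanish. *)
Lemma diag_slope_eq0 v x : injective (crit x) ->
  (forall i, (diag_slope v x).[crit x i] = 0) -> diag_slope v x = 0.
Proof.
move=> ci G0; set G := diag_slope v x in G0 *.
have dvd : crit_prod x %| G.
  rewrite crit_prodE; apply: uniq_roots_dvdp; last first.
    by rewrite uniq_rootsE map_inj_uniq ?enum_uniq.
  by apply/allP => _ /mapP[i _ ->]; apply/rootP.
have [c Gc] : exists c, G = c *: crit_prod x.
  have [->|Gn0] := eqVneq G 0; first by exists 0; rewrite scale0r.
  have : crit_prod x %= G.
    rewrite -dvdp_size_eqp // eqn_leq dvdp_leq // size_crit_prod.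
    exact: size_diag_slope.
  move=> /eqp_eq; set a := lead_coef G; set b := lead_coef (crit_prod x) => E.
  have b1 : b = 1 by apply/monicP; exact: monic_prod_XsubC.
  by exists a; rewrite E b1 scale1r.
have := deriv_diag_slope_crit v x i0; rewrite -/G eqxx Gc derivZ hornerZ.
rewrite /crit_prod (bigD1 i0) //= derivM derivXsubC mul1r hornerD hornerM.
rewrite hornerXsubC subrr mul0r addr0 horner_prod => /eqP.
rewrite mulf_eq0 => /orP[/eqP ->|]; first by rewrite scale0r.
rewrite prodf_seq_eq0 => /hasP[j _ /andP[ji0]].
by rewrite hornerXsubC subr_eq0 => /eqP/ci/eqP; rewrite eq_sym (negbTE ji0).
Qed.

Definition coef_chart x : 'rV[K]_N := \row_j (crit_poly x)`_(bump 1 j).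

Definition coef_slope (z : 'rV[K]_N * 'rV[K]_N) : 'M[K]_N :=
  \matrix_(k, j) (poly_slope k z.1 z.2)`_(bump 1 j).

Lemma coef_chartB x y :
  coef_chart x - coef_chart y = (x - y) *m coef_slope (x, y).
Proof.
apply/rowP => j; rewrite !mxE -coefB crit_polyB coef_sum.
by apply: eq_bigr => k _; rewrite coefZ !mxE.
Qed.

(** A kernel vector gives a G whose coefficients vanish at all exponents but 1; the remaining one is
    G'(0) = 0. *)
Lemma coef_slope_unit x : i0 = 0%N :> nat -> injective (crit x) ->
  coef_slope (x, x) \in unitmx.
Proof.
move=> i00 ci; apply: unitmx_inj => v vD; apply: (diag_slope_inj ci).
have Gb j : (j < N)%N -> (diag_slope v x)`_(bump 1 j) = 0.
  move=> jN; move/rowP/(_ (Ordinal jN)) : vD; rewrite !mxE; apply: etrans.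
  by rewrite /diag_slope coef_sum; apply: eq_bigr => k _; rewrite coefZ !mxE.
apply/polyP => m; rewrite coef0.
have [->|m1] := eqVneq m 1%N.
  have := deriv_diag_slope_crit v x i0; rewrite eqxx /crit eqxx.
  by rewrite horner_coef0 coef_deriv.
have [mN|Nm] := leqP m N; last first.
  by rewrite nth_default // (leq_trans (size_diag_slope _ _)).
have := Gb (unbump 1 m); rewrite unbumpKcond (negbTE m1) add0n; apply.
case: m m1 mN => [|[|m]] //= _ _.
by have := ltn_ord i0; rewrite i00.
Qed.

Variable b : 'I_N -> 'I_N.

Definition value x i : K := (crit_poly x).[crit x i].

(** A critical value varies with the polynomial and with the critical point. The second contribution
    concerns only the point's own coordinate, and is absent for [i0], whose point stays at 0. *)
Definition value_slope (k i : 'I_N) x y : K :=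
  (poly_slope k x y).[crit x i] +
  if (k == i) && (i != i0) then
    horner_slope N.+2 (crit_poly y) (crit x i) (crit y i) else 0.

Lemma valueB x y i :
  value x i - value y i = \sum_k (x 0 k - y 0 k) * value_slope k i x y.
Proof.
rewrite /value -[X in X - _](subrK (crit_poly y).[crit x i]) -addrA.
rewrite (horner_slopeP _ _ (size_crit_poly_le y)) -hornerN -hornerD crit_polyB.
rewrite horner_sum; under [RHS]eq_bigr do rewrite mulrDr.
rewrite big_split /=; congr (_ + _).
  by apply: eq_bigr => k _; rewrite hornerZ.
rewrite (bigD1 i) //= big1 ?addr0 => [|k ki]; last by rewrite (negbTE ki) mulr0.
rewrite eqxx /= {1 2}/crit; case: eqP => [->|] /=; last by [].
by rewrite subrr mul0r mulr0.
Qed.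

(** To first order, moving a critical point does not change the value there, as the derivative
    vanishes. *)
Lemma value_slope_diag k i x :
  value_slope k i x x = (poly_slope k x x).[crit x i].
Proof.
rewrite /value_slope horner_slope_diag ?size_crit_poly_le //.
suff /rootP -> : root (crit_poly x)^`() (crit x i) by rewrite if_same addr0.
by rewrite root_deriv_crit_poly; apply/existsP; exists i.
Qed.

(* With [b] sending an index to the representative of its block, the
   vanishing of the non-representative coordinates says that the critical
   values are constant on the blocks. *)
Definition value_chart x : 'rV[K]_N :=
  \row_i (value x i - if b i == i then 0 else value x (b i)).

Definition value_chart_slope (z : 'rV[K]_N * 'rV[K]_N) : 'M[K]_N :=
  \matrix_(k, i) (value_slope k i z.1 z.2 -
                  if b i == i then 0 else value_slope k (b i) z.1 z.2).

Lemma value_chartB x y :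
  value_chart x - value_chart y = (x - y) *m value_chart_slope (x, y).
Proof.
apply/rowP => i; rewrite !mxE.
under eq_bigr do rewrite !mxE mulrBr.
rewrite sumrB -valueB; case: ifP => _.
  by rewrite !subr0 [X in _ = _ - X]big1 ?subr0 // => k _; rewrite mulr0.
by rewrite -valueB; ring.
Qed.

(** For a kernel vector, G vanishes first at the representatives, then, by the differences, at all
    other critical points. *)
Lemma value_chart_slope_unit x : (forall i, b (b i) = b i) ->
  injective (crit x) -> value_chart_slope (x, x) \in unitmx.
Proof.
move=> bb ci; apply: unitmx_inj => v vD; apply: (diag_slope_inj ci).
apply: (diag_slope_eq0 ci).
have vE i : (v *m value_chart_slope (x, x)) 0 i = (diag_slope v x).[crit x i] -
    if b i == i then 0 else (diag_slope v x).[crit x (b i)].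
  rewrite !mxE /diag_slope !horner_sum.
  have -> : (if b i == i then 0 else
      \sum_k (v 0 k *: poly_slope k x x).[crit x (b i)]) =
      \sum_k v 0 k * (if b i == i then 0 else value_slope k (b i) x x).
    case: ifP => _; first by rewrite big1 // => k _; rewrite mulr0.
    by apply: eq_bigr => k _; rewrite hornerZ value_slope_diag.
  rewrite -sumrB; apply: eq_bigr => k _.
  by rewrite mxE /= mulrBr hornerZ !value_slope_diag.
have Gb i : b i = i -> (diag_slope v x).[crit x i] = 0.
  by move=> bi; have := vE i; rewrite vD bi eqxx mxE /= subr0.
move=> i; have [bi|bi] := eqVneq (b i) i; first exact: Gb.
by have := vE i; rewrite vD mxE (negbTE bi) /= (Gb (b i)) ?bb // subr0.
Qed.

Section Continuity.
Variables (T : topologicalType).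
Implicit Types u w : T -> 'rV[K]_N.

Lemma crit_continuous u i : continuous u -> continuous (fun t => crit (u t) i).
Proof.
move=> uc t; rewrite /continuous_at /crit.
case: (i == i0); first exact: cvg_cst.
by apply: cvg_coord; exact: uc.
Qed.

Lemma crit_poly_continuous u : continuous u ->
  coef_continuous (fun t => crit_poly (u t)).
Proof.
move=> uc; apply: coef_continuousD.
  apply: coef_continuous_primitive; apply: coef_continuousZ.
  apply: coef_continuous_prod => i _; apply: coef_continuousD.
    exact: coef_continuous_cst.
  under eq_fun do rewrite -polyCN.
  apply: coef_continuousC => t; apply: cvgN; exact: crit_continuous.
by apply: coef_continuousC => t; apply: cvg_coord; exact: uc.
Qed.

Lemma poly_slope_continuous k u w : continuous u -> continuous w ->
  coef_continuous (fun t => poly_slope k (u t) (w t)).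
Proof.
move=> uc wc; rewrite /poly_slope; case: (k == i0).
  exact: coef_continuous_cst.
apply: coef_continuousZ; apply: coef_continuous_primitive.
have XC (c : T -> K) : continuous c ->
    coef_continuous (fun t => 'X - (c t)%:P).
  move=> cc; apply: coef_continuousD; first exact: coef_continuous_cst.
  under eq_fun do rewrite -polyCN.
  by apply: coef_continuousC => t; apply: cvgN; exact: cc.
apply: coef_continuous_prod => i _; case: (i < k)%N; apply: XC;
  exact: crit_continuous.
Qed.

Lemma value_continuous u i : continuous u ->
  continuous (fun t => value (u t) i).
Proof.
move=> uc.
exact: (continuous_horner_coef (fun t => size_crit_poly_le (u t))
  (crit_poly_continuous uc) (@crit_continuous u i uc)).
Qed.

Lemma value_slope_continuous k i u w : continuous u -> continuous w ->
  continuous (fun t => value_slope k i (u t) (w t)).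
Proof.
move=> uc wc t; apply: (@cvgD _ _ _ (nbhs t) _
  (fun t => (poly_slope k (u t) (w t)).[crit (u t) i])).
  exact: (continuous_horner_coef (fun t => size_poly_slope k (u t) (w t))
    (@poly_slope_continuous k u w uc wc) (@crit_continuous u i uc)).
case: (_ && _); last exact: cvg_cst.
exact: (@continuous_horner_slope _ _ N.+2 _ _ _ (crit_poly_continuous wc)
  (@crit_continuous u i uc) (@crit_continuous w i wc)).
Qed.

End Continuity.

Let fst_continuous : continuous (fst : 'rV[K]_N * 'rV[K]_N -> 'rV[K]_N).
Proof. by move=> z; exact: cvg_fst. Qed.

Let snd_continuous : continuous (snd : 'rV[K]_N * 'rV[K]_N -> 'rV[K]_N).
Proof. by move=> z; exact: cvg_snd. Qed.

Lemma coef_slope_continuous : continuous coef_slope.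
Proof.
move=> z; apply: cvg_mx => k j; rewrite mxE; under eq_cvg do rewrite mxE.
exact: poly_slope_continuous.
Qed.

Lemma value_chart_slope_continuous : continuous value_chart_slope.
Proof.
move=> z; apply: cvg_mx => k j; rewrite mxE; under eq_cvg do rewrite mxE.
apply: cvgB; first exact: value_slope_continuous.
by case: (_ == _); [exact: cvg_cst|exact: value_slope_continuous].
Qed.

End CriticalPointFamily.

(** * Blocks of critical points *)

Lemma card_eq_seqP (T : choiceType) (A : set T) n :
  (A #= `I_n)%card <-> exists s : seq T,
    [/\ uniq s, size s = n & forall x, A x <-> x \in s].
Proof.
split=> [An|[s [us <- As]]].
  have fA : finite_set A by apply/finite_setP; exists n.
  exists (enum_fset (fset_set A)); split; first exact: fset_uniq.
    exact: card_fset_set An.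
  move=> x; rewrite -[x \in _]/(x \in fset_set A) in_fset_set //.
  by split=> [/mem_set|/set_mem].
have -> : A = [set` [fset x in s]%fset].
  by apply/seteqP; split=> x /=; rewrite !inE => /As.
by apply/card_eq_fsetP; rewrite card_fseq undup_id.
Qed.

(** Let G = A Q. From G' = A' Q + A Q' and the coprimality of Q and Q', Q also divides A; comparing
    degrees, G = Q^2. *)
Lemma double_roots_square (C : fieldType) (G : {poly C}) (rs : seq C) :
  G \is monic -> size G = (size rs).*2.+1 -> uniq rs ->
  (forall z, z \in rs -> root G z && root G^`() z) ->
  G = (\prod_(z <- rs) ('X - z%:P)) ^+ 2.
Proof.
move=> mG sG urs rG; set Q := \prod_(z <- rs) _.
have mQ : Q \is monic by exact: monic_prod_XsubC.
have sQ : size Q = (size rs).+1 by rewrite size_prod_XsubC.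
have dvdQ p : (forall z, z \in rs -> root p z) -> Q %| p.
  move=> rp; apply: uniq_roots_dvdp; last by rewrite uniq_rootsE.
  by apply/allP.
have cQ : coprimep Q Q^`().
  by have := separable_prod_XsubC rs; rewrite urs unlock.
have /dvdpP[A GA] : Q %| G by apply: dvdQ => z /rG /andP[].
have : Q %| G^`() by apply: dvdQ => z /rG /andP[].
rewrite GA derivM (dvdp_addr _ (dvdp_mull _ (dvdpp Q))) Gauss_dvdpl // =>
  /dvdpP[B AB].
have mB : B \is monic by move: mG; rewrite GA AB !monicMr.
have sB : size B = 1%N.
  move: sG; rewrite GA AB -mulrA !size_monicM ?mulf_neq0 ?monic_neq0 //.
  rewrite sQ -addnn => sG; lia.
have /size_poly1P[c _ Bc] : size B == 1%N by apply/eqP.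
by move: mB; rewrite AB Bc monicE lead_coefC => /eqP ->;
rewrite mul1r expr2.
Qed.

Lemma size_deriv_numDomain (C : numDomainType) (p : {poly C}) :
  size p^`() = (size p).-1.
Proof.
apply/eqP; rewrite eqn_leq size_poly /=.
case sp : (size p) => [|[|m]] //=; rewrite ltnNge; apply/negP => sd.
have : p^`()`_m = 0 by rewrite nth_default.
rewrite coef_deriv => /eqP; rewrite mulrn_eq0 /=.
have -> : p`_m.+1 = lead_coef p by rewrite lead_coefE sp.
by rewrite lead_coef_eq0 -size_poly_eq0 sp.
Qed.

(** * Critical points of compositions of quadratic polynomials *)

Section Iteration.
Variable R : realType.
Implicit Types (s : seq R[i]) (z : R[i]).

Lemma quad_comp_rcons s a :
  quad_comp (rcons s a) = (quad_comp s) ^+ 2 + a%:P.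
Proof.
rewrite /quad_comp -cats1 foldl_cat /= /quad_poly.
by rewrite comp_polyD comp_polyC comp_Xn_poly.
Qed.

Lemma quad_comp_monic s :
  quad_comp s \is monic /\ size (quad_comp s) = (2 ^ size s).+1.
Proof.
elim/last_ind: s => [|s a [mF sF]].
  by rewrite /quad_comp /= monicX size_polyX.
rewrite quad_comp_rcons size_rcons.
have sF2 : size (quad_comp s ^+ 2) = (2 ^ (size s).+1).+1.
  rewrite expr2 size_monicM ?monic_neq0 // sF expnS mul2n -addnn.
  by rewrite addnS addSn.
have sa : (size (a%:P : {poly R[i]}) < size (quad_comp s ^+ 2)%R)%N.
  by rewrite sF2 ltnS (leq_trans (size_polyC_leq1 _)) // expn_gt0.
split; last by rewrite size_polyDl.
by rewrite monicE lead_coefDl // -monicE expr2 monicMr.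
Qed.

(** Iterated chain rule: the critical points are the zeros of the intermediate compositions, the one
    for [k = 0] being 'X. *)
Lemma deriv_quad_comp s :
  (quad_comp s)^`() =
  (2 ^ size s)%:R *: \prod_(k < size s) quad_comp (take k s).
Proof.
elim/last_ind: s => [|s a IH].
  by rewrite /quad_comp /= big_ord0 derivX scale1r.
rewrite quad_comp_rcons derivD derivC addr0 deriv_exp /= IH.
rewrite size_rcons big_ord_recr /= -cats1 take_size_cat // expr1.
rewrite -scalerAl -scaler_nat scalerA -natrM -expnS; congr (_ *: (_ * _)).
by apply: eq_bigr => k _; rewrite takel_cat // ltnW.
Qed.

(* F' is separable, as it has as many roots as its degree; hence the factors
   [quad_comp (take k s)] of F' are separable and pairwise coprime. *)
Lemma quad_comp_root_blocks s :
  (critical_points (quad_comp s) #= `I_(2 ^ size s - 1))%card ->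
  [/\ forall k, (k < size s)%N ->
        ([set z | root (quad_comp (take k s)) z] #= `I_(2 ^ k))%card,
      forall j k z, (j < size s)%N -> (k < size s)%N ->
        root (quad_comp (take j s)) z -> root (quad_comp (take k s)) z ->
        j = k &
      forall z, critical_points (quad_comp s) z <->
        exists2 k, (k < size s)%N & root (quad_comp (take k s)) z].
Proof.
move=> /card_eq_seqP[e [ue se ecrit]].
set F := quad_comp s in ecrit *.
have c0 : (2 ^ size s)%:R != 0 :> R[i] by rewrite pnatr_eq0 expn_eq0.
have dF : F^`() = (2 ^ size s)%:R *: \prod_(k < size s) quad_comp (take k s).
  exact: deriv_quad_comp.
set P := \prod_(k < size s) _ in dF.
have mP : P \is monic.
  by apply: monic_prod => k _; case: (quad_comp_monic (take k s)).
have PE : P = \prod_(z <- e) ('X - z%:P).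
  have sP : size P = (size e).+1.
    rewrite -(size_scale _ c0) -dF se size_deriv_numDomain.
    by rewrite (quad_comp_monic s).2 subn1 prednK ?expn_gt0.
  rewrite (@all_roots_prod_XsubC _ P e) ?uniq_rootsE //.
    by rewrite (monicP mP) scale1r.
  by apply/allP => z /ecrit; rewrite /critical_points /= dF rootZ.
have sepP : separable_poly P by rewrite PE separable_prod_XsubC.
have dvdP k : (k < size s)%N -> quad_comp (take k s) %| P.
  move=> ks; rewrite /P (bigD1 (Ordinal ks)) //=.
  exact: dvdp_mulr.
split.
- move=> k ks; have [r rE] := closed_field_poly_normal (quad_comp (take k s)).
  have [mk sk] := quad_comp_monic (take k s).
  rewrite (monicP mk) scale1r in rE.
  apply/card_eq_seqP; exists r; split.
  + by rewrite -separable_prod_XsubC -rE;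
      exact: dvdp_separable (dvdP _ ks) sepP.
  + by move: sk; rewrite rE size_prod_XsubC size_takel 1?ltnW // => -[].
  + by move=> z; rewrite /= rE root_prod_XsubC.
- move=> j k z js ks rj rk; apply/eqP; apply/negPn/negP => jk.
  have : coprimep (quad_comp (take j s)) (quad_comp (take k s)).
    apply: separable_coprime sepP _.
    rewrite /P (bigD1 (Ordinal js)) //= (bigD1 (Ordinal ks)) //=.
      by rewrite mulrA dvdp_mulr.
    by rewrite -val_eqE /= eq_sym.
  by move=> /coprimep_root /(_ rj); rewrite (rootP rk) eqxx.
- move=> z; rewrite /critical_points /= dF rootZ //.
  rewrite rootE horner_prod prodf_seq_eq0.
  split=> [/hasP[k _ /andP[_ rk]]|[k ks rk]]; first by exists k.
  by apply/hasP; exists (Ordinal ks); rewrite ?mem_index_enum.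
Qed.

End Iteration.

(** * Membership in B_n in terms of numbered critical points *)

Section Blocks.
Variables (R : realType) (n : nat).
Let M := (2 ^ n - 1)%N.
Variable i0 : 'I_M.
Hypothesis i00 : i0 = 0%N :> nat.
Implicit Types (x : 'rV[R[i]]_M) (F : {poly R[i]}) (blk : 'I_M -> nat).

Lemma succM : (2 ^ n)%N = M.+1.
Proof. by rewrite /M subn1 prednK // expn_gt0. Qed.

Lemma n_gt0 : (0 < n)%N.
Proof.
have : (0 < M)%N := leq_ltn_trans (leq0n _) (ltn_ord i0).
by rewrite /M; case: (n).
Qed.

Lemma leqnM : (n <= M)%N.
Proof. by rewrite -ltnS -succM ltn_expl. Qed.

(* [blk i] is the number of the block [L_k] containing the [i]-th critical
   point; critical points are numbered so that the [k]-th one, [k < n], lies in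
   [L_k]. *)
Definition block_index blk :=
  [/\ forall i, (blk i < n)%N, forall i : 'I_M, (i < n)%N -> blk i = i &
      forall k, (k < n)%N -> #|[pred i | blk i == k]| = (2 ^ k)%N].

Definition rep (k : nat) : 'I_M := insubd i0 k.

Lemma repE k : (k < n)%N -> rep k = k :> nat.
Proof. by move=> kn; rewrite val_insubd (leq_trans kn leqnM). Qed.

Lemma blk_rep blk k : block_index blk -> (k < n)%N -> blk (rep k) = k.
Proof. by case=> _ blkE _ kn; rewrite blkE repE. Qed.

Lemma blk_eq0 blk i : block_index blk -> blk i = 0%N -> i = i0.
Proof.
move=> [blkn blkE blkc] bi; have n0 : (0 < n)%N by rewrite -bi.
have /card1P[j jP] : #|[pred i | blk i == 0%N]| == 1%N by rewrite blkc.
have : i \in pred1 j by rewrite -jP inE bi.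
have : i0 \in pred1 j by rewrite -jP inE blkE i00.
by rewrite !inE => /eqP -> /eqP ->.
Qed.

Lemma critical_points_crit_poly x z :
  critical_points (crit_poly i0 x) z <-> z \in codom (crit i0 x).
Proof.
rewrite /critical_points /= root_deriv_crit_poly.
split=> [/existsP[i /eqP ->]|/codomP[i ->]]; first exact: codom_f.
by apply/existsP; exists i.
Qed.

Lemma critical_values_crit_poly x v :
  critical_values (crit_poly i0 x) v <-> exists i, v = value i0 x i.
Proof.
split=> [[z /critical_points_crit_poly/codomP[i ->] <-]|[i ->]].
  by exists i.
by exists (crit i0 x i) => //; apply/critical_points_crit_poly; exact: codom_f.
Qed.

Lemma Pn_crit_poly x : Pn n (crit_poly i0 x).
Proof.
split; [exact: crit_poly_monic|by rewrite size_crit_poly succM|].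
by apply/critical_points_crit_poly; rewrite -(crit0 i0 x) codom_f.
Qed.

Lemma coef_vec_crit_poly x : coef_vec n (crit_poly i0 x) = coef_chart i0 x.
Proof. by apply/rowP => j; rewrite !mxE. Qed.

Lemma Bn_crit_poly x blk : block_index blk -> injective (crit i0 x) ->
  (forall i j, (value i0 x i == value i0 x j) = (blk i == blk j)) ->
  Bn n (crit_poly i0 x).
Proof.
move=> bx ci vE; have [blkn blkE blkc] := bx; split.
- split; first exact: Pn_crit_poly.
  apply/card_eq_seqP; exists (codom (crit i0 x)); split.
  + by rewrite map_inj_uniq ?enum_uniq.
  + by rewrite size_codom card_ord.
  + exact: critical_points_crit_poly.
- apply/card_eq_seqP; exists [seq value i0 x (rep k) | k <- iota 0 n]; split.
  + rewrite map_inj_in_uniq ?iota_uniq // => j k; rewrite !mem_iota /= => jn kn.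
    by move=> /eqP; rewrite vE !blk_rep // => /eqP.
  + by rewrite size_map size_iota.
  + move=> v; rewrite critical_values_crit_poly; split=> [[i ->]|/mapP[k _ ->]].
      apply/mapP; exists (blk i); first by rewrite mem_iota /= blkn.
      by apply/eqP; rewrite vE blk_rep.
    by exists (rep k).
exists (fun k => [set z | exists2 i, blk i = k & z = crit i0 x i]); split.
- split.
  + apply/seteqP; split=> [z [k _ [i _ ->]]|z].
      by apply/critical_points_crit_poly; exact: codom_f.
    move=> /critical_points_crit_poly/codomP[i ->].
    by exists (blk i); [exact: blkn|exists i].
  + by move=> j k _ _ [z [[i <- ->] [i' <- /ci ->]]].
  + by move=> k kn; exists (crit i0 x (rep k)), (rep k) => //; exact: blk_rep.
- apply/seteqP; split=> [z [i /(blk_eq0 bx) -> ->]|_ ->]; first exact: crit0.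
  by exists i0; rewrite ?crit0 // blkE // i00; have := blkn i0; case: (n).
- move=> k kn; apply/card_eq_seqP.
  exists [seq crit i0 x i | i <- enum [pred i | blk i == k]]; split.
  + by rewrite map_inj_uniq ?enum_uniq.
  + by rewrite size_map -cardE blkc.
  + move=> z; split=> [[i bi ->]|/mapP[i im ->]]; last first.
      by exists i => //; move: im; rewrite mem_enum inE => /eqP.
    by apply/mapP; exists i; rewrite ?mem_enum ?inE ?bi.
- move=> k kn; exists (value i0 x (rep k)); apply/seteqP; split.
    move=> _ [_ [i bi ->] <-]; apply/eqP.
    by rewrite -[_.[_]]/(value i0 x i) vE bi blk_rep.
  move=> _ ->; exists (crit i0 x (rep k)) => //.
  by exists (rep k) => //; exact: blk_rep.
Qed.

(** The [n] representatives already take [n] distinct values, which exhaust the critical values.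
    Each critical point therefore shares its value with some representative, and by separation only
    with that of its own block. The partition hidden in [Bn] is thus forced to be [blk]. *)
Lemma Bn_value_eq x blk : block_index blk -> Bn n (crit_poly i0 x) ->
  (forall i j, blk i != blk j -> value i0 x i != value i0 x j) ->
  forall i j, (value i0 x i == value i0 x j) = (blk i == blk j).
Proof.
move=> bx [_ /card_eq_seqP[t [ut st tE]] _] vn.
have [blkn blkE blkc] := bx.
pose r := [seq value i0 x (rep k) | k <- iota 0 n].
have ur : uniq r.
  rewrite map_inj_in_uniq ?iota_uniq // => j k; rewrite !mem_iota /= => jn kn.
  move=> /eqP; apply: contraTeq => jk; apply: vn.
  by rewrite !blk_rep.
have rt : {subset r <= t}.
  by move=> _ /mapP[k _ ->]; apply/tE/critical_values_crit_poly; exists (rep k).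
have [] := uniq_min_size ur rt; first by rewrite st size_map size_iota.
move=> _ rEt.
have vrep i : value i0 x i = value i0 x (rep (blk i)).
  have : value i0 x i \in t by apply/tE/critical_values_crit_poly; exists i.
  rewrite -rEt => /mapP[k]; rewrite mem_iota /= => kn vk.
  suff -> : blk i = k by [].
  rewrite -[RHS](blk_rep bx kn); apply/eqP/negPn/negP => /vn.
  by rewrite vk eqxx.
move=> i j; apply/idP/idP => [|/eqP ij]; first exact: contraLR (vn i j).
by rewrite (vrep i) (vrep j) ij.
Qed.

(** The partition clause of [Bn] with [L] exposed, so that for compositions the blocks can be chosen
    as zero sets of the intermediate compositions. *)
Definition Bn_blocks F (L : nat -> set R[i]) :=
  [/\ partition `I_n L (critical_points F),
      L 0%N = [set 0],
      (forall i, (i < n)%N -> (L i #= `I_(2 ^ i))%card) &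
      (forall i, (i < n)%N ->
         exists v, (fun z => F.[z]) @` L i = [set v])].

Lemma Bn_encode F (L : nat -> set R[i]) :
  Pn_nd n F -> (critical_values F #= `I_n)%card -> Bn_blocks F L ->
  exists x blk, [/\ F = crit_poly i0 x, injective (crit i0 x), block_index blk,
    forall i, L (blk i) (crit i0 x i) &
    forall i j, (value i0 x i == value i0 x j) = (blk i == blk j)].
Proof.
move=> [[mF sF F0] /card_eq_seqP[e [ue se eE]]] /card_eq_seqP[t [ut st tE]].
move=> [[Lc Lt Ln] L0 Lcard Lv].
have rP k : exists z : R[i], (k < n)%N -> L k z.
  by have [kn|] := ltnP k n; [have [z] := Ln _ kn; exists z|exists 0].
have [r rL] := choice rP.
have Lcrit k z : (k < n)%N -> L k z -> z \in e.
  by move=> kn Lz; apply/eE; rewrite -Lc; exists k.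
have Lblk z : z \in e -> exists2 k, (k < n)%N & L k z.
  by move=> /eE; rewrite -Lc => -[k kn Lz]; exists k.
have Linj j k z : (j < n)%N -> (k < n)%N -> L j z -> L k z -> j = k.
  by move=> jn kn Lj Lk; apply: Lt => //; exists z.
pose sr := [seq r k | k <- iota 0 n].
(* One point of each block comes first, in the order of the blocks, as [block_index] asks; since the
   block 0 is {0}, the critical point 0 gets the index [i0]. *)
pose s := sr ++ [seq z <- e | z \notin sr].
have ssr : size sr = n by rewrite size_map size_iota.
have us : uniq s.
  rewrite cat_uniq filter_uniq // andbT; apply/andP; split.
    rewrite map_inj_in_uniq ?iota_uniq // => j k.
    rewrite !mem_iota /= => jn kn E.
    by apply: (Linj _ _ (r j)) => //; [exact: rL|rewrite E; exact: rL].
  by apply/hasPn => z; rewrite mem_filter => /andP[].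
have sre z : z \in sr -> z \in e.
  by move=> /mapP[k]; rewrite mem_iota => kn ->; exact: Lcrit (rL _ kn).
have sme : s =i e.
  move=> z; rewrite mem_cat mem_filter; have [/sre ->|] //= := boolP (z \in sr).
have ss : size s = M.
  by apply: etrans se; exact/perm_size/uniq_perm.
have sn k : (k < n)%N -> s`_k = r k.
  move=> kn; rewrite nth_cat ssr kn (nth_map 0%N) ?size_iota //.
  by rewrite nth_iota.
pose x : 'rV[R[i]]_M := \row_i (if i == i0 then F`_0 else s`_i).
have cx i : crit i0 x i = s`_i.
  rewrite /crit; case: eqP => [->|/eqP ii0]; last by rewrite mxE (negbTE ii0).
  by rewrite i00 sn ?n_gt0 //; have := rL _ n_gt0; rewrite L0 => ->.
have ms (i : 'I_M) : s`_i \in e by rewrite -sme mem_nth // ss.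
have bP (i : 'I_M) : exists k : nat, (k < n)%N /\ L k s`_i.
  by have [k kn Lk] := Lblk _ (ms i); exists k.
have [blk blkP] := choice bP.
have blkE k (i : 'I_M) : (k < n)%N -> L k s`_i -> blk i = k.
  by move=> kn Lk; have [bn Lb] := blkP i; exact: Linj Lb Lk.
have ci : injective (crit i0 x).
  move=> i j /eqP; rewrite !cx nth_uniq ?ss // => /eqP; exact: val_inj.
have vP k : exists w : R[i], (k < n)%N -> (fun z => F.[z]) @` L k = [set w].
  by have [kn|] := ltnP k n; [have [w] := Lv _ kn; exists w|exists 0].
have [v vL] := choice vP.
have FL k z : (k < n)%N -> L k z -> F.[z] = v k.
  move=> kn Lz; have : ((fun z => F.[z]) @` L k) F.[z] by exists z.
  by rewrite vL.
(* The [n] block values cover all [n] critical values, hence are distinct. *)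
have uv : uniq [seq v k | k <- iota 0 n].
  apply: (leq_size_uniq ut); last by rewrite size_map size_iota st.
  move=> w /tE [z /eE/Lblk[k kn Lz] <-]; apply/mapP; exists k.
    by rewrite mem_iota.
  exact: FL.
have dF : F^`() = M.+1%:R *: crit_prod i0 x.
  have sdF : size F^`() = (size s).+1.
    by rewrite size_deriv_numDomain sF /= ss -succM.
  rewrite [LHS](@all_roots_prod_XsubC _ _ s) ?uniq_rootsE //; last first.
    by apply/allP => z; rewrite sme => /eE.
  congr (_ *: _).
    rewrite lead_coefE sdF /= ss coef_deriv -succM.
    by move/monicP : mF; rewrite lead_coefE sF /= => ->.
  rewrite (big_nth 0) big_mkord ss /crit_prod; apply: eq_bigr => i _.
  by rewrite cx.
have Fx : F = crit_poly i0 x.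
  by apply: crit_poly_surj => //; [rewrite sF succM|rewrite mxE eqxx].
exists x, blk; split => //.
- split.
  + by move=> i; case: (blkP i).
  + by move=> i iin; apply: blkE => //; rewrite sn //; exact: rL.
  + move=> k kn; have /card_eq_seqP[l [ul <- lE]] := Lcard _ kn.
    rewrite cardE -(size_map (fun i : 'I_M => s`_i)); apply: perm_size.
    apply: uniq_perm => //.
      rewrite map_inj_in_uniq ?enum_uniq // => i j _ _ /eqP.
      by rewrite nth_uniq ?ss // => /eqP; exact: val_inj.
    move=> z; apply/mapP/idP => [[i im ->]|/lE Lz].
      move: im; rewrite mem_enum inE => /eqP bi.
      by apply/lE; rewrite -bi; case: (blkP i).
    have zs : z \in s by rewrite sme; exact: Lcrit Lz.
    have zi : (index z s < M)%N by rewrite -ss index_mem.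
    exists (Ordinal zi); last by rewrite /= nth_index.
    by rewrite mem_enum inE; apply/eqP/blkE => //=; rewrite nth_index.
- by move=> i; rewrite cx; case: (blkP i).
- have vx i : value i0 x i = v (blk i).
    have [bn Lb] := blkP i.
    by rewrite /value -Fx; apply: FL => //; rewrite cx.
  move=> i j; rewrite !vx; have [bi _] := blkP i; have [bj _] := blkP j.
  have vb k : (k < n)%N -> v k = [seq v k | k <- iota 0 n]`_k.
    by move=> kn; rewrite (nth_map 0%N) ?size_iota // nth_iota.
  by rewrite (vb _ bi) (vb _ bj) nth_uniq ?size_map ?size_iota.
Qed.

End Blocks.

(** * Charts *)

Section Chart.
Variables (R : realType) (n : nat).
Let M := (2 ^ n - 1)%N.
Variable i0 : 'I_M.
Hypothesis i00 : i0 = 0%N :> nat.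
Implicit Types (x : 'rV[R[i]]_M) (blk : 'I_M -> nat).

(** Open conditions, valid at a point of B_n, that fix the partition nearby. *)
Definition separated blk x :=
  injective (crit i0 x) /\
  (forall i j, blk i != blk j -> value i0 x i != value i0 x j).

Lemma separated_near blk x0 : separated blk x0 ->
  \forall x \near x0, separated blk x.
Proof.
move=> [ci vn].
have idc : continuous (id : 'rV[R[i]]_M -> 'rV[R[i]]_M).
  by move=> x; exact: cvg_id.
have H1 : \forall x \near x0, forall i j,
    i != j -> crit i0 x i - crit i0 x j != 0.
  apply: (@filter_forall _ _ _ (nbhs x0)) => i.
  apply: (@filter_forall _ _ _ (nbhs x0)) => j.
  have [->|ij] := eqVneq i j; first by near=> x.
  have : crit i0 x0 i - crit i0 x0 j != 0.
    by rewrite subr_eq0; apply: contraNneq ij => /ci ->.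
  have c : (fun x => crit i0 x i - crit i0 x j) @ x0 -->
      crit i0 x0 i - crit i0 x0 j.
    by apply: (@cvgB _ _ _ (nbhs x0) _ (fun x => crit i0 x i)
      (fun x => crit i0 x j));
      exact: (@crit_continuous _ _ i0 _ id _ idc).
  by move/(cvgr_neq0 _ c); apply: filterS => x + _.
have H2 : \forall x \near x0, forall i j, blk i != blk j ->
    value i0 x i - value i0 x j != 0.
  apply: (@filter_forall _ _ _ (nbhs x0)) => i.
  apply: (@filter_forall _ _ _ (nbhs x0)) => j.
  have [_|ij] := eqVneq (blk i) (blk j); first exact: nearW.
  have : value i0 x0 i - value i0 x0 j != 0 by rewrite subr_eq0; exact: vn.
  have c : (fun x => value i0 x i - value i0 x j) @ x0 -->
      value i0 x0 i - value i0 x0 j.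
    by apply: (@cvgB _ _ _ (nbhs x0) _ (fun x => value i0 x i)
      (fun x => value i0 x j));
      exact: (@value_continuous _ _ i0 _ id _ idc).
  by move/(cvgr_neq0 _ c); apply: filterS => x + _.
near=> x; split.
  move=> i j cij; apply/eqP/negPn/negP => ij.
  have /(_ i j ij) : forall i j, i != j -> crit i0 x i - crit i0 x j != 0.
    by near: x.
  by rewrite cij subrr eqxx.
move=> i j ij; rewrite -subr_eq0.
have : forall i j, blk i != blk j -> value i0 x i - value i0 x j != 0.
  by near: x.
exact.
Unshelve. all: by end_near. Qed.

(** Both [coef_chart] and [value_chart] are locally invertible at [x0]; on a common domain, passing
    from coefficients to critical values is biholomorphic. The neighbourhood [O] leaves room for a
    further open condition. *)
Lemma chart blk x0 (O : set 'rV[R[i]]_M) :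
  block_index blk -> separated blk x0 -> nbhs x0 O ->
  exists (U : set 'rV[R[i]]_M) (psi1 psi2 : 'rV[R[i]]_M -> 'rV[R[i]]_M),
  [/\ U x0, U `<=` O, U `<=` separated blk &
   biholomorphism (coef_chart i0 @` U) (value_chart i0 (rep i0 \o blk) @` U)
     (value_chart i0 (rep i0 \o blk) \o psi1) (coef_chart i0 \o psi2) /\
   (forall x, U x -> psi1 (coef_chart i0 x) = x)].
Proof.
move=> bx sx Ox; set b := rep i0 \o blk.
have bb i : b (b i) = b i.
  by rewrite /b /= (blk_rep i0 bx) //; case: bx.
have ci := sx.1.
have [W1 [psi1 [oW1 W1x H1]]] := 
  slope_local_inverse (@complex_geometric_complete R)
    (@coef_chartB _ _ i0) (@coef_slope_continuous _ _ i0)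
    (coef_slope_unit i00 ci).
have [W2 [psi2 [oW2 W2x H2]]] := 
  slope_local_inverse (@complex_geometric_complete R)
    (@value_chartB _ _ i0 b) (@value_chart_slope_continuous _ _ i0 b)
  (value_chart_slope_unit bb ci).
pose G : set 'rV[R[i]]_M := (O `&` separated blk)°.
have Gx : G x0 by apply: filterI => //; exact: separated_near.
pose U := W1 `&` W2 `&` G.
have oU : open U by apply: openI; [exact: openI|exact: open_interior].
have [oc dc dp1 p1K] := H1 U oU (fun x Ux => Ux.1.1).
have [ov dv dp2 p2K] := H2 U oU (fun x Ux => Ux.1.2).
exists U, psi1, psi2; split => //.
- by move=> x [_ /interior_subset[]].
- by move=> x [_ /interior_subset[]].
split=> //; split => //.
- split=> _ [x Ux <-]; apply: differentiable_comp.
  + by apply: dp1; exists x.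
  + by rewrite p1K //; exact: dv.
  + by apply: dp2; exists x.
  + by rewrite p2K //; exact: dc.
- move=> _ [x Ux <-]; rewrite /= p1K // p2K //; split=> //.
  by exists x.
- move=> _ [x Ux <-]; rewrite /= p2K // p1K //; split=> //.
  by exists x.
Qed.

Lemma coef_vec_inj F x : Pn n F -> coef_vec n F = coef_chart i0 x ->
  F = crit_poly i0 x.
Proof.
move=> PF; rewrite -coef_vec_crit_poly => E.
have [_ inj _] := coef_vec_bij R (n_gt0 i0).
by apply: inj E; apply/mem_set => //; exact: Pn_crit_poly.
Qed.

Lemma Bn_submanifold : complex_submanifold n (coef_vec n @` @Bn R n).
Proof.
split; first exact: leqnM.
move=> _ [F [ndF cF [L bL]] <-].
have [x0 [blk [Fx ci bx _ vE]]] := Bn_encode i00 ndF cF bL.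
have sx : separated blk x0 by split=> // i j; rewrite -vE.
have [U [psi1 [psi2 [Ux _ sU [bU p1K]]]]] :=
  chart bx sx (@filterT _ _ (nbhs_filter x0)).
set b := rep i0 \o blk in bU.
exists (coef_chart i0 @` U), (value_chart i0 b @` U).
exists (value_chart i0 b \o psi1), (coef_chart i0 \o psi2); split => //.
  by exists x0 => //; rewrite Fx coef_vec_crit_poly.
have [blkn blkE blkc] := bx.
(* The representatives are the first [n] indices, so the coordinates from [n] on are the differences
   of critical values within the blocks. *)
have bE (j : 'I_M) : (b j == j) = (j < n)%N.
  apply/eqP/idP => [<-|jn]; first by rewrite /b /= repE.
  by apply: val_inj; rewrite /= repE blkE.
(* On separated vectors no partition has to be chosen any more: B_n is cut out by the equalities
   within the fixed blocks. *)
have wE x : separated blk x ->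
    Bn n (crit_poly i0 x) <->
    (forall j : 'I_M, (n <= j)%N -> value_chart i0 b x ord0 j = 0).
  move=> [cix vx]; split=> [Bx j nj|H].
    have vEx := Bn_value_eq bx Bx vx.
    rewrite mxE bE ltnNge nj /=; apply/eqP; rewrite subr_eq0 vEx.
    by rewrite /b /= (blk_rep i0 bx).
  apply: (Bn_crit_poly i00 bx) => //.
  have vb i : value i0 x i = value i0 x (b i).
    have [ni|ni] := ltnP i n; first by move: ni; rewrite -bE => /eqP ->.
    by have := H i ni; rewrite mxE bE ltnNge ni /= => /subr0_eq.
  move=> i j; apply/idP/idP => [|/eqP ij]; first exact: contraLR (vx i j).
  by rewrite (vb i) (vb j) /b /= ij.
apply/seteqP; split.
  move=> _ [_ [[x Ux' <-] [G BG GE]] <-]; rewrite /= p1K //.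
  split; first by exists x.
  apply/wE; first exact: sU.
  rewrite -(coef_vec_inj _ GE) //.
  by case: BG => -[].
move=> _ [[x Ux' <-] /= H]; exists (coef_chart i0 x); last by rewrite /= p1K.
split; first by exists x.
exists (crit_poly i0 x); last exact: coef_vec_crit_poly.
by apply/wE => //; exact: sU.
Qed.

(** * Openness of Pol_n^nd in B_n *)

Definition block_diff blk x k i : R[i] :=
  \prod_(l | blk l == k) (crit i0 x i - crit i0 x l).

(** The open condition that selects the sign in the descent: the monic polynomial with zeros in
    block [k] never takes opposite values at two points of the same earlier block. *)
Definition nonopposite blk x := forall (k : 'I_n) i j,
  (blk i == blk j) && (blk i < k)%N ->
  block_diff blk x k i + block_diff blk x k j != 0.

Lemma nonopposite_near blk x0 : nonopposite blk x0 ->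
  \forall x \near x0, nonopposite blk x.
Proof.
move=> H.
have idc : continuous (id : 'rV[R[i]]_M -> 'rV[R[i]]_M).
  by move=> x; exact: cvg_id.
apply: (@filter_forall _ _ _ (nbhs x0)) => k.
apply: (@filter_forall _ _ _ (nbhs x0)) => i.
apply: (@filter_forall _ _ _ (nbhs x0)) => j.
have [c|_] := boolP ((blk i == blk j) && (blk i < k)%N); last exact: nearW.
have dc m : (fun x => block_diff blk x k m) @ x0 --> block_diff blk x0 k m.
  apply: (@cvg_bigprod _ _ _ (nbhs x0)) => l _.
  by apply: (@cvgB _ _ _ (nbhs x0) _ (fun x => crit i0 x m)
      (fun x => crit i0 x l));
    exact: (@crit_continuous _ _ i0 _ id _ idc).
have : (fun x => block_diff blk x k i + block_diff blk x k j) @ x0 -->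
    block_diff blk x0 k i + block_diff blk x0 k j.
  by apply: (@cvgD _ _ _ (nbhs x0) _ (fun x => block_diff blk x k i)).
by move/cvgr_neq0/(_ (H k i j c)); apply: filterS => x + _.
Qed.

Definition block_prod blk x k : {poly R[i]} :=
  \prod_(l | blk l == k) ('X - (crit i0 x l)%:P).

Lemma block_prodE blk x k : block_prod blk x k =
  \prod_(z <- [seq crit i0 x l | l <- enum [pred l | blk l == k]]) ('X - z%:P).
Proof. by rewrite big_map big_enum. Qed.

Lemma horner_block_prod blk x k i :
  (block_prod blk x k).[crit i0 x i] = block_diff blk x k i.
Proof.
by rewrite /block_prod horner_prod; apply: eq_bigr => l _; rewrite hornerXsubC.
Qed.

(* The critical points in the last block are double roots of [F - v], where [v]
   is their common value, so [F - v] is the square of a polynomial with one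
   block less.  Its values on a block agree up to sign, hence agree. *)
Lemma Poln_of_nonopposite blk x : block_index blk -> injective (crit i0 x) ->
  (forall i j, blk i = blk j -> value i0 x i = value i0 x j) ->
  nonopposite blk x -> Poln n (crit_poly i0 x).
Proof.
move=> bx ci vE sg; have [blkn blkE blkc] := bx.
(* The descent runs on polynomials of degree [2 ^ k] whose critical points are the first [k] blocks.
   For [k = 0] these conditions leave the constant term free, hence the last premise. *)
suff main k G : (k <= n)%N -> G \is monic -> size G = (2 ^ k).+1 ->
    G^`() = (2 ^ k)%:R *: \prod_(l | (blk l < k)%N) ('X - (crit i0 x l)%:P) ->
    (forall i j, blk i = blk j -> (blk i < k)%N ->
      G.[crit i0 x i] = G.[crit i0 x j]) ->
    (k = 0%N -> G = 'X) -> exists2 s, size s = k & G = quad_comp s.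
  apply: (main n) => //.
  - exact: crit_poly_monic.
  - by rewrite size_crit_poly succM.
  - rewrite deriv_crit_poly succM; congr (_ *: _).
    by apply: eq_bigl => l; rewrite blkn.
  - by move=> i j /vE.
  - by move=> n0; exfalso; move: (n_gt0 i0); rewrite n0.
elim: k G => [|k IH] G kn mG sG dG cG G0; first by exists [::]; rewrite ?G0.
set Q := block_prod blk x k.
have mQ : Q \is monic by rewrite /Q block_prodE; exact: monic_prod_XsubC.
have sQ : size Q = (2 ^ k).+1.
  by rewrite /Q block_prodE size_prod_XsubC size_map -cardE blkc.
set v := G.[crit i0 x (rep i0 k)].
have sv : (size (- v%:P)%R < size G)%N.
  by rewrite size_polyN sG ltnS (leq_trans (size_polyC_leq1 _)) // expn_gt0.
have GE : G = Q ^+ 2 + v%:P.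
  apply/eqP; rewrite -subr_eq; apply/eqP; rewrite /Q block_prodE.
  apply: double_roots_square.
  - by rewrite monicE lead_coefDl // -monicE.
  - by rewrite size_polyDl // sG size_map -cardE blkc // expnS mul2n.
  - by rewrite map_inj_uniq ?enum_uniq.
  - move=> z /mapP[l]; rewrite mem_enum inE => /eqP bl ->; apply/andP; split.
      rewrite rootE hornerD hornerN hornerC subr_eq0; apply/eqP/cG.
        by rewrite (blk_rep i0 bx).
      by rewrite bl.
    rewrite derivB derivC subr0 dG rootZ ?pnatr_eq0 ?expn_eq0 //.
    rewrite rootE horner_prod prodf_seq_eq0; apply/hasP; exists l.
      exact: mem_index_enum.
    by rewrite bl ltnSn hornerXsubC subrr eqxx.
have dQ : Q^`() =
    (2 ^ k)%:R *: \prod_(l | (blk l < k)%N) ('X - (crit i0 x l)%:P).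
  move: dG; rewrite GE derivD derivC addr0 deriv_exp /= expr1.
  rewrite (bigID (fun l => blk l == k)) /=.
  rewrite (eq_bigl (fun l => blk l == k)) => [|l]; last first.
    by have [->|] := eqVneq (blk l) k; rewrite ?ltnSn ?andbF.
  rewrite -/(block_prod blk x k) -/Q.
  rewrite [X in _ *: (_ * X)](eq_bigl (fun l => (blk l < k)%N)) => [|l];
    last first.
    by rewrite ltnS ltn_neqAle andbC.
  (* Here G' = 2 Q Q', and Q and 2 are cancelled. *)
  move=> dG'; apply: (mulfI (monic_neq0 mQ)).
  apply: (@scalerI _ _ (2%:R : R[i])); first by rewrite pnatr_eq0.
  by rewrite -scalerAr scalerA -natrM -expnS -dG' scaler_nat mulrC.
have [| | |s ss Qs] := IH Q _ mQ sQ dQ; first exact: ltnW.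
- move=> i j bij bk; rewrite /Q !horner_block_prod.
  have : Q.[crit i0 x i] ^+ 2 == Q.[crit i0 x j] ^+ 2.
    have := cG i j bij (ltnW bk).
    by rewrite GE !hornerD !hornerC !horner_exp => /addIr ->.
  rewrite eqf_sqr -addr_eq0 /Q !horner_block_prod => /orP[/eqP //|].
  by rewrite (negbTE (sg (Ordinal kn) i j _)) //= bij eqxx -bij.
- move=> k0; rewrite /Q /block_prod k0 (big_pred1 i0) ?crit0 ?subr0 // => l.
  rewrite /= -val_eqE; apply/eqP/eqP => [/(blk_eq0 i00 bx) -> //|li].
  by rewrite (_ : l = i0) ?blkE ?i00 //; [lia|exact: val_inj].
by exists (rcons s v); rewrite ?size_rcons ?ss // quad_comp_rcons -Qs.
Qed.

(** Later compositions factor through earlier ones. *)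
Lemma horner_quad_comp_take s j k z z' : (j <= k <= size s)%N ->
  (quad_comp (take j s)).[z] = (quad_comp (take j s)).[z'] :> R[i] ->
  (quad_comp (take k s)).[z] = (quad_comp (take k s)).[z'].
Proof.
move=> /andP[jk ks] E; elim: k jk ks => [|k IH].
  by rewrite leqn0 => /eqP j0 _; move: E; rewrite j0.
rewrite leq_eqVlt => /orP[/eqP <- //|jk] ks.
rewrite (take_nth 0 ks) quad_comp_rcons !hornerD !hornerC !horner_exp.
by rewrite IH // ltnW.
Qed.

Lemma Poln_blocks s : size s = n -> Pn_nd n (quad_comp s) ->
  Bn_blocks n (quad_comp s)
    (fun k => [set z : R[i] | root (quad_comp (take k s)) z]).
Proof.
move=> sn [PF]; rewrite -{1}sn => cF.
have [H1 H2 H3] := quad_comp_root_blocks cF; rewrite sn in H1 H2 H3.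
have ne k : (k < n)%N -> [set z : R[i] | root (quad_comp (take k s)) z] !=set0.
  move=> kn; have /card_eq_seqP[l [_ sl lE]] := H1 _ kn.
  case: l sl lE => [|z l] sl lE; first by have := expn_gt0 2 k; rewrite -sl.
  by exists z; apply/lE; rewrite mem_head.
split => //.
- split=> //.
  + apply/seteqP; split=> [z [k kn rz]|z /H3[k kn rz]]; last by exists k.
    by apply/H3; exists k.
  + by move=> j k jn kn [z [/= rj rk]]; exact: H2 rj rk.
- by apply/seteqP; split=> z; rewrite /= take0 rootE hornerX => /eqP.
- move=> k kn; have [z0 rz0] := ne _ kn; exists (quad_comp s).[z0].
  apply/seteqP; split=> [_ [z rz <-]|_ ->]; last by exists z0.
  have tn : take n s = s by rewrite -sn take_size.
  rewrite /= -tn; apply: (@horner_quad_comp_take _ k).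
    by rewrite sn leqnn andbT ltnW.
  by move/rootP : rz => ->; move/rootP : rz0 => ->.
Qed.

Lemma Poln_nd_sub_Bn : @Poln_nd R n `<=` @Bn R n.
Proof.
move=> _ [[s sn ->] ndF cF]; split=> //.
exists (fun k => [set z : R[i] | root (quad_comp (take k s)) z]).
exact: Poln_blocks.
Qed.

(** The polynomial of block [k] is the intermediate composition [quad_comp (take k s)]. On an
    earlier block it has a constant value w, nonzero because the zero sets are disjoint, so the sum
    is 2w. *)
Lemma nonopposite_quad_comp s blk x : size s = n ->
  quad_comp s = crit_poly i0 x -> Pn_nd n (quad_comp s) ->
  injective (crit i0 x) -> block_index blk ->
  (forall i, root (quad_comp (take (blk i) s)) (crit i0 x i)) ->
  nonopposite blk x.
Proof.
move=> sn Fx [_]; rewrite -{1}sn => cF ci bx rx k i j /andP[/eqP bij bk].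
have [blkn blkE blkc] := bx.
have [_ H2 _] := quad_comp_root_blocks cF; rewrite sn in H2.
have Qk : block_prod blk x k = quad_comp (take k s).
  have [mk sk] := quad_comp_monic (take k s).
  rewrite block_prodE; set rs := [seq _ | _ <- _].
  rewrite [RHS](@all_roots_prod_XsubC _ _ rs).
  - by rewrite (monicP mk) scale1r.
  - by rewrite sk size_takel ?sn 1?ltnW // size_map -cardE blkc.
  - by apply/allP => z /mapP[l]; rewrite mem_enum inE => /eqP <- ->.
  - by rewrite uniq_rootsE map_inj_uniq ?enum_uniq.
rewrite -!horner_block_prod Qk.
have -> : (quad_comp (take k s)).[crit i0 x j] =
    (quad_comp (take k s)).[crit i0 x i].
  apply: (@horner_quad_comp_take _ (blk i)); first by rewrite ltnW //= sn ltnW.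
  by rewrite (rootP (rx i)) {1}bij (rootP (rx j)).
rewrite -mulr2n mulrn_eq0 /=; apply/negP => rk.
by have := H2 _ _ _ (blkn i) (ltn_ord k) (rx i) rk; move: bk => /ltn_eqF/eqP.
Qed.

Lemma Poln_nd_open : open (@coef_vec R n @` @Poln_nd R n
  : set (subspace (@coef_vec R n @` @Bn R n))).
Proof.
set B := coef_vec n @` @Bn R n; set P := coef_vec n @` @Poln_nd R n.
(* This open set meets [B] within [P]; it remains to show that each point of [P] is interior to the
   union. *)
apply/open_subspaceP; exists (~` B `|` P)°; first exact: open_interior.
apply/seteqP; split=> [p [/interior_subset[] //]|p [Pp Bp]]; split=> //.
have [F PF Fp] := Pp; have [[s sn Fs] ndF cF] := PF; rewrite Fs in ndF cF Fp.
have bL := Poln_blocks sn ndF.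
have [x0 [blk [Fx ci bx Lx vE]]] := Bn_encode i00 ndF cF bL.
have sx : separated blk x0 by split=> // i j; rewrite -vE.
have nx : nonopposite blk x0 by exact: nonopposite_quad_comp sn Fx ndF ci bx Lx.
have [U [psi1 [psi2 [Ux UO sU [[oU _ _ _ _] _]]]]] :=
  chart bx sx (nonopposite_near nx).
have Up : (coef_chart i0 @` U) p.
  by exists x0; rewrite // -Fp Fx coef_vec_crit_poly.
rewrite /interior; apply: (@filterS _ _ _ (coef_chart i0 @` U)); last first.
  exact: open_nbhs_nbhs.
move=> _ [x Ux' <-].
have [Bx|Bx] := pselect (B (coef_chart i0 x)); last by left.
right; have [G BG GE] := Bx.
have Gx : G = crit_poly i0 x by apply: coef_vec_inj GE; case: BG => -[].
exists G => //; rewrite Gx in BG *.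
have [cix vx] := sU _ Ux'.
have vEx := Bn_value_eq bx BG vx.
have [ndG cG _] := BG; split=> //.
apply: (Poln_of_nonopposite bx cix) => [i j bij|]; last exact: UO.
by apply/eqP; rewrite vEx bij.
Qed.

End Chart.

Theorem proposition3p5 (R : realType) (n : nat) (hn : (1 <= n)%N) :
  complex_submanifold n (@coef_vec R n @` @Bn R n) /\
  (@Poln_nd R n `<=` @Bn R n /\
   open (@coef_vec R n @` @Poln_nd R n
           : set (subspace (@coef_vec R n @` @Bn R n)))).
Proof.
have M0 : (0 < 2 ^ n - 1)%N by rewrite subn_gt0 -[1%N](expn0 2) ltn_exp2l.
pose i0 := Ordinal M0; have i00 : i0 = 0%N :> nat by [].
split; first exact: Bn_submanifold i00.
by split; [exact: Poln_nd_sub_Bn|exact: Poln_nd_open i00].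
Qed.
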